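(* Let $R$ be the (continuous) covariance function of the i.i.d. components of a continuous centered Gaussian process in $\mathbb{R}^d$ starting at the origin. Let $g(s,t)=\mathbf{1}_{[0,t)}(s)\,\tilde g_1(t)\,\tilde g_2(s)$, where $\tilde g_1,\tilde g_2\in\mathcal{C}^{p\text{-var}}_{pw}([0,T];\mathbb{R}^d\otimes\mathbb{R}^d)$, and for a partition $\pi=\{r_i\}$ of $[0,T]$ let $g^\pi(s,t):=\sum_ig(s,r_i)\mathbf{1}_{[r_i,r_{i+1})}(t)$. Let $R$ be of finite 2D $\rho$-variation, $\rho\in[1,\frac32)$, and assume $\frac1p+\frac1\rho>1$. Then $g\in\mathcal{H}^d_1\otimes\mathcal{H}^d_1$, with norm given by $$\|g\|_{\mathcal{H}^d_1\otimes\mathcal{H}^d_1}=\sqrt{\int_{[0,T]^2}\Big(\int_{[0,T]^2}\langle g(u,s),g(v,t)\rangle_{\mathbb{R}^d\otimes\mathbb{R}^d}\,\mathrm{d}R(u,v)\Big)\mathrm{d}R(s,t)},$$ and $$\|g^\pi-g\|_{\mathcal{H}^d_1\otimes\mathcal{H}^d_1}\to0\quad\text{as }\|\pi\|\to0.$$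
   Context: 2-tensors are identified with matrices, $\tilde g_1(t)\tilde g_2(s)$ is a matrix product, and $\langle\cdot,\cdot\rangle_{\mathbb{R}^d\otimes\mathbb{R}^d}$ is the Euclidean (Hilbert–Schmidt) inner product. $\mathcal{C}^{p\text{-var}}_{pw}([0,T];E)$: functions $f$ for which there is a partition $\{t_i\}$ of $[0,T]$ such that $f$ is continuous with finite $p$-variation on each $(t_i,t_{i+1})$. Rectangular increment: $R\begin{pmatrix}a&b\\c&d\end{pmatrix}=R(a,c)+R(b,d)-R(a,d)-R(b,c)$; finite 2D $\rho$-variation means $\sup\sum_{i,j}\big|R\begin{pmatrix}u_i&u_{i+1}\\ v_j&v_{j+1}\end{pmatrix}\big|^\rho<\infty$ over grid partitions. Integrals are 2D Young–Stieltjes integrals, $\int_{[0,T]^2}f\,\mathrm{d}R=\lim_{\|\pi\|\to0}\sum_{i,j}f(u_i,v_j)R\begin{pmatrix}u_i&u_{i+1}\\ v_j&v_{j+1}\end{pmatrix}$. $\mathcal{H}^d_1$ is the completion of the linear span of $\{\mathbf{1}_{[0,t)}e_u\}$ under $\langle\mathbf{1}_{[0,t)}e_u,\mathbf{1}_{[0,s)}e_v\rangle=\delta_{uv}R(t,s)$; a path in $\mathcal{C}^{p\text{-var}}_{pw}([0,T];\mathbb{R}^d)$ is identified with the $\mathcal{H}_1^d$-limit of its step-function approximations $\sum_if(r_i)\mathbf{1}_{[r_i,r_{i+1})}$. A matrix-valued function of the form $(s,t)\mapsto A(s)\mathbf{1}_{[a,b)}(t)$, with $(k,j)$ entries $a^{(k)}_j(s)$,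 is identified with $\sum_{j,k}a^{(k)}_j(s)e_k\otimes\mathbf{1}_{[a,b)}(t)e_j$, so that $g^\pi$ is an element of $\mathcal{H}^d_1\otimes\mathcal{H}^d_1$ (Hilbert tensor product). $g$ is identified with the limit of $g^{\pi}$ in $\mathcal{H}^d_1\otimes\mathcal{H}^d_1$ as $\|\pi\|\to0$. *)

(* Defs.v *)
From HB Require Import structures.
From mathcomp Require Import all_boot all_order all_algebra.
From mathcomp Require Import all_classical all_reals all_analysis.

Set Implicit Arguments.
Unset Strict Implicit.
Unset Printing Implicit Defensive.

Import Order.TTheory GRing.Theory Num.Theory.
Import numFieldNormedType.Exports.

Local Open Scope classical_set_scope.
Local Open Scope ring_scope.

(* As in [itv_partition a b r], a partition a = r_0 < ... < r_n = b is encoded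
   by the sequence r = [:: r_1; ...; r_n]; [pnt a r i] is r_i. *)
Definition pnt (R : realType) (a : R) (r : seq R) (i : nat) : R :=
  nth a (a :: r) i.

Definition mesh (R : realType) (a : R) (r : seq R) : R :=
  \big[Num.max/0]_(i < size r) (pnt a r i.+1 - pnt a r i).

(* "as the mesh tends to 0", along the partitions of [0, T] *)
Definition mesh_to0 (R : realType) (T : R) : set_system (seq R) :=
  filter_from [set delta : R | 0 < delta]
    (fun delta => [set r | itv_partition 0 T r /\ mesh 0 r < delta]).

Definition finite_pvar_on (R : realType) (E : normedModType R) (p : R)
    (f : R -> E) (D : set R) : Prop :=
  exists M : R, forall (x : R) (s : seq R),
    path <%R x s -> (forall y, y \in x :: s -> D y) ->
    \sum_(k < size s) `|f (pnt x s k.+1) - f (pnt x s k)| `^ p <= M.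

Definition Cpw_pvar (R : realType) (E : normedModType R) (p T : R)
    (f : R -> E) : Prop :=
  exists2 r : seq R, itv_partition 0 T r &
    forall i, (i < size r)%N ->
      {within `]pnt 0 r i, pnt 0 r i.+1[, continuous f} /\
      finite_pvar_on p f `]pnt 0 r i, pnt 0 r i.+1[.

Definition rect_incr (R : realType) (K : R -> R -> R) (a b c d : R) : R :=
  K a c + K b d - K a d - K b c.

Definition finite_2D_var (R : realType) (rho T : R) (K : R -> R -> R) : Prop :=
  exists M : R, forall r q : seq R,
    itv_partition 0 T r -> itv_partition 0 T q ->
    \sum_(i < size r) \sum_(j < size q)
      `|rect_incr K (pnt 0 r i) (pnt 0 r i.+1) (pnt 0 q j) (pnt 0 q j.+1)|
        `^ rho <= M.

Definition young2_sum (R : realType) (K f : R -> R -> R)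
    (rq : seq R * seq R) : R :=
  \sum_(i < size rq.1) \sum_(j < size rq.2)
    f (pnt 0 rq.1 i) (pnt 0 rq.2 j) *
    rect_incr K (pnt 0 rq.1 i) (pnt 0 rq.1 i.+1)
                (pnt 0 rq.2 j) (pnt 0 rq.2 j.+1).

Definition young2_integrable (R : realType) (T : R) (K f : R -> R -> R) : Prop :=
  cvg (young2_sum K f @ filter_prod (mesh_to0 T) (mesh_to0 T)).

(* Meaningful only when [young2_integrable T K f]. *)
Definition young2_int (R : realType) (T : R) (K f : R -> R -> R) : R :=
  lim (young2_sum K f @ filter_prod (mesh_to0 T) (mesh_to0 T)).

Definition hs_inner (R : realType) (d : nat) (A B : 'M[R]_d) : R :=
  \sum_(i < d) \sum_(j < d) A i j * B i j.

Section GaussianProcess.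
Context {dO : measure_display} {Omega : measurableType dO} {R : realType}.
Variables (P : probability Omega R) (d : nat) (T : R).
(* [X t i] is the i-th component at time t. *)
Variable X : R -> 'I_d -> {RV P >-> R}.

(* The degenerate case is separate because [normal_prob m 0] is not [\d_m]. *)
Definition centered_gaussian_law (Y : Omega -> R) : Prop :=
  (exists2 sigma : R, 0 < sigma &
     (forall A : set R, measurable A -> P (Y @^-1` A) = normal_prob 0 sigma A)) \/
  (forall A : set R, measurable A -> P (Y @^-1` A) = \d_(0 : R) A).

Definition centered_gaussian_process : Prop :=
  forall (n : nat) (t : 'I_n -> R) (i : 'I_n -> 'I_d) (a : 'I_n -> R),
    (forall k, t k \in `[0, T]) ->
    centered_gaussian_law (fun w => \sum_(k < n) a k * X (t k) (i k) w).

Definition continuous_from_origin : Prop :=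
  {ae P, forall w, forall i : 'I_d,
     X 0 i w = 0 /\ {within `[0, T], continuous (fun t => X t i w)}}.

Definition component_sigma (i : 'I_d) : set_system Omega :=
  <<s [set E | exists t : R, exists A : set R,
         [/\ t \in `[0, T], measurable A & E = X t i @^-1` A]] >>.

Definition independent_components : Prop :=
  forall E : 'I_d -> set Omega, (forall i, component_sigma i (E i)) ->
    P (\bigcap_i E i) = (\prod_(i < d) P (E i))%E.

Definition identically_distributed_components : Prop :=
  forall (i j : 'I_d) (n : nat) (t : 'I_n -> R) (A : 'I_n -> set R),
    (forall k, t k \in `[0, T]) -> (forall k, measurable (A k)) ->
    P (\bigcap_k (X (t k) i @^-1` A k)) = P (\bigcap_k (X (t k) j @^-1` A k)).

Definition component_covariance (K : R -> R -> R) : Prop :=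
  forall (i : 'I_d) (s t : R), s \in `[0, T] -> t \in `[0, T] ->
    covariance P (X s i) (X t i) = (K s t)%:E.

End GaussianProcess.

(* A real Hilbert space is a complete normed module whose norm is induced by an
   inner product. Completions and Hilbert tensor products are characterised up
   to isometric isomorphism. *)

Record is_inner_product (R : realType) (V : normedModType R)
    (dot : V -> V -> R) : Prop := IsInnerProduct {
  dot_sym : forall x y, dot x y = dot y x ;
  dot_linear : forall a x y z, dot (a *: x + y) z = a * dot x z + dot y z ;
  dot_norm : forall x, dot x x = `|x| ^+ 2 }.

Definition lin_span (R : realType) (V : normedModType R) (S : set V) : set V :=
  [set x | exists n : nat, exists a : 'I_n -> R, exists v : 'I_n -> V,
     (forall k, S (v k)) /\ x = \sum_(k < n) a k *: v k].

(* H is the completion of the span of the 1_[0,t) e_u for t in [0, T];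
   [ind t u] is the image of 1_[0,t) e_u. *)
Record is_H1 (R : realType) (d : nat) (T : R) (K : R -> R -> R)
    (H : completeNormedModType R) (dot : H -> H -> R)
    (ind : R -> 'I_d -> H) : Prop := IsH1 {
  H1_inner : is_inner_product dot ;
  H1_ind : forall (t s : R) (u v : 'I_d), t \in `[0, T] -> s \in `[0, T] ->
    dot (ind t u) (ind s v) = (u == v)%:R * K t s ;
  H1_dense : dense (lin_span [set x | exists t : R, exists u : 'I_d,
    t \in `[0, T] /\ x = ind t u]) }.

Record is_hilbert_tensor (R : realType) (H1 H2 : completeNormedModType R)
    (dot1 : H1 -> H1 -> R) (dot2 : H2 -> H2 -> R)
    (tens : H1 -> H1 -> H2) : Prop := IsHilbertTensor {
  tens_inner : is_inner_product dot2 ;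
  tens_linl : forall a x y z, tens (a *: x + y) z = a *: tens x z + tens y z ;
  tens_linr : forall a x y z, tens z (a *: x + y) = a *: tens z x + tens z y ;
  tens_dot : forall x y x' y',
    dot2 (tens x y) (tens x' y') = dot1 x x' * dot1 y y' ;
  tens_dense : dense (lin_span [set z | exists x, exists y, z = tens x y]) }.

Section Embeddings.
Context {R : realType} {d : nat} {H1 H2 : completeNormedModType R}.
Variables (T : R) (ind : R -> 'I_d -> H1) (tens : H1 -> H1 -> H2).

(* 1_[a,b) e_u *)
Definition ind_itv (a b : R) (u : 'I_d) : H1 := ind b u - ind a u.

(* sum_i f(r_i) 1_[r_i, r_{i+1}) *)
Definition step_approx (f : R -> 'cV[R]_d) (r : seq R) : H1 :=
  \sum_(i < size r) \sum_(u < d)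
    f (pnt 0 r i) u 0 *: ind_itv (pnt 0 r i) (pnt 0 r i.+1) u.

Definition path_in_H1 (f : R -> 'cV[R]_d) : Prop :=
  cvg (step_approx f @ mesh_to0 T).

(* Meaningful only when [path_in_H1 f]. *)
Definition path_elem (f : R -> 'cV[R]_d) : H1 :=
  lim (step_approx f @ mesh_to0 T).

(* (s, t) |-> A(s) 1_[a,b)(t), i.e. sum_j (A(.) e_j) (x) 1_[a,b) e_j *)
Definition mx_step_elem (A : R -> 'M[R]_d) (a b : R) : H2 :=
  \sum_(j < d) tens (path_elem (fun s => col j (A s))) (ind_itv a b j).

(* g^r (s, t) = sum_i g(s, r_i) 1_[r_i, r_{i+1})(t) *)
Definition gpi_elem (g : R -> R -> 'M[R]_d) (r : seq R) : H2 :=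
  \sum_(i < size r)
    mx_step_elem (fun s => g s (pnt 0 r i)) (pnt 0 r i) (pnt 0 r i.+1).

(* g is identified with the limit of the g^r as the mesh of r tends to 0. *)
Definition in_H1H1 (g : R -> R -> 'M[R]_d) : Prop :=
  (forall (t : R) (j : 'I_d), t \in `[0, T] ->
     path_in_H1 (fun s => col j (g s t))) /\
  cvg (gpi_elem g @ mesh_to0 T).

(* Meaningful only when [in_H1H1 g]. *)
Definition g_elem (g : R -> R -> 'M[R]_d) : H2 :=
  lim (gpi_elem g @ mesh_to0 T).

End Embeddings.

Definition volterra_g (R : realType) (d : nat) (g1 g2 : R -> 'M[R]_d)
    (s t : R) : 'M[R]_d :=
  \1_(`[0, t[ : set R) s *: (g1 t *m g2 s).

(* Main.v *)
Require Import Defs.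
From HB Require Import structures.
From mathcomp Require Import all_boot all_order all_algebra.
From mathcomp Require Import all_classical all_reals all_analysis.
From mathcomp Require Import ring lra zify.

Set Implicit Arguments.
Unset Strict Implicit.
Unset Printing Implicit Defensive.

Import Order.TTheory GRing.Theory Num.Theory.
Import numFieldNormedType.Exports.

Local Open Scope classical_set_scope.
Local Open Scope ring_scope.

(** Everything takes place in the Hilbert space of the process. The indicator
    [ind t u] is a path [t |-> x^u_t] in this space whose Gram kernel is the
    covariance [K], and every quantity in the statement is a norm or an inner
    product of Riemann sums against this path. Indeed a step function
    [sum_i f(r_i) 1_[r_i, r_{i+1})] is the Riemann sum of [f dx], and an inner
    product of two Riemann sums is a two-dimensional Young sum against [K]
    ([dot_step_approx], [dot_gpi_elem]). So, once the Riemann sums are known to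
    converge in norm, both Young integrals exist, with limits the inner products
    of the limits, and the formula for the norm of [g] is the case of two equal
    arguments. What remains is the convergence of two families of Riemann sums:
    [sum_i f(r_i) (x_{r_{i+1}} - x_{r_i})] in [H1], for a scalar [f] of finite
    [q]-variation, and [sum_i Z_{r_i} (x) (x_{r_{i+1}} - x_{r_i})] in the tensor
    square, where [Z_t] is the column [int 1_[0,t)(s) g(s,t) e_l dx_s].

    Both follow from a sewing lemma in Hilbert spaces ([hilbert_sewing]). The
    integrator [x] has finite [2 rho]-variation in norm only, which is not enough
    for the classical sewing argument, where partition points are removed one
    at a time and the errors are added in norm. Here a fine partition is coarsened
    dyadically: at level [k] a whole batch of points is removed at once, and the
    squared norm of the resulting error is the double sum
    [sum_{c,c'} G_{c,c'} K_{c,c'}] of the rectangular increments of the Gram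
    kernels of the integrand and of the integrator. Its terms involve small [G]
    and the grid variations of [G] and [K], of exponents [q] and [rho] with
    [1/q + 1/rho > 1]; hence it is at most a geometric sequence in [k]
    ([young_product]). No superadditive two-dimensional control is used, and
    jumps of the integrand do no harm because [K] is small on small rectangles.

    To apply this to [Z] one needs the grid variation of [<Z_s, Z_t>]. As
    [Z_t] is a sum of products of entries of [g1(t)] with integrals
    [y_t = int 1_[0,t) phi dx], and multiplication by a function of finite
    [q]-variation preserves finite grid variation ([grid_bvMl]), it suffices to
    bound the grid variation of [<y_s, y_t>]. This is done by integrating one
    variable at a time ([grid_bv_young_integral]): the scalar Young estimate
    bounds [<y_t - y_s, v>] by the [rho]-variation of [<x, v>] on [[s, t]], and
    a duality argument ([dual_variation]) upgrades it to an estimate for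
    the vector of all increments in the other variable, with one common control. *)

(** * Monotone chains and dyadic sewing *)
Section Chains.
Context {R : realType}.
Implicit Types (a b : R) (u : nat -> R).

(** Partitions of subintervals of [[a, b]] in which points may be repeated:
    empty dyadic cells then need no special treatment. *)
Definition chain a b (n : nat) u : Prop :=
  (forall i, (i < n)%N -> u i <= u i.+1) /\
  (forall i, (i <= n)%N -> a <= u i <= b).

Lemma steps_le (n : nat) u : (forall i, (i < n)%N -> u i <= u i.+1) ->
  forall i j, (i <= j)%N -> (j <= n)%N -> u i <= u j.
Proof.
move=> H i; elim=> [|j IH]; first by rewrite leqn0 => /eqP ->.
rewrite leq_eqVlt => /predU1P[-> //|ij jn].
by apply: le_trans (H j jn); apply: IH => //; apply: ltnW.
Qed.

Lemma steps_lt (n : nat) u : (forall i, (i < n)%N -> u i < u i.+1) ->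
  forall i j, (i < j)%N -> (j <= n)%N -> u i < u j.
Proof.
move=> H i j ij jn; apply: (@lt_le_trans _ _ (u i.+1)).
  by apply: H; apply: leq_trans jn.
by apply: (@steps_le n) => // k /H /ltW.
Qed.

Definition first_above (f : nat -> R) (n : nat) (y : R) : nat :=
  find (fun j => y <= f j) (iota 0 n).

Lemma first_above_le f n y : (first_above f n y <= n)%N.
Proof. by rewrite -{2}(size_iota 0 n) find_size. Qed.

Lemma first_above_before f n y j : (j < first_above f n y)%N -> f j < y.
Proof.
move=> jl; have := before_find 0%N jl.
rewrite nth_iota ?add0n; last exact: leq_trans jl (first_above_le _ _ _).
by move/negbT; rewrite -ltNge.
Qed.

Lemma first_above_at f n y : (first_above f n y < n)%N ->
  y <= f (first_above f n y).
Proof.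
move=> h; have := @nth_find _ 0%N (fun j => y <= f j) (iota 0 n).
by rewrite has_find size_iota => /(_ h); rewrite nth_iota.
Qed.

Lemma first_above_eq f n y i : (i <= n)%N ->
  (forall j, (j < i)%N -> f j < y) -> ((i < n)%N -> y <= f i) ->
  first_above f n y = i.
Proof.
move=> ile bef at_; case: (ltngtP (first_above f n y) i) => // h.
  have := first_above_at (leq_trans h ile).
  by rewrite leNgt bef.
have := first_above_before h.
by rewrite ltNge at_ // (leq_trans h (first_above_le _ _ _)).
Qed.

Lemma first_above_mono f n y z : y <= z ->
  (first_above f n y <= first_above f n z)%N.
Proof.
move=> yz; rewrite leqNgt; apply/negP => h.
have h1 := first_above_before h.
have h2 := first_above_at (leq_trans h (first_above_le _ _ _)).
by move: (lt_le_trans h1 yz); rewrite ltNge h2.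
Qed.

End Chains.

Lemma sum_double (V : nmodType) (F : nat -> V) n :
  \sum_(i < n.*2) F i = \sum_(i < n) (F i.*2 + F i.*2.+1).
Proof.
elim: n => [|n IH]; first by rewrite !big_ord0.
by rewrite doubleS !big_ord_recr /= IH addrA.
Qed.

(** A walk by steps 0 and 1 visits every index, and its pauses contribute
    nothing; this identifies the finest dyadic sum with the sum over the
    fine partition. *)
Lemma sum_walk (T : Type) (V : nmodType) (Xi : T -> T -> V) (q : nat -> T)
    (sig : nat -> nat) (n : nat) :
  (forall x, Xi x x = 0) -> sig 0%N = 0%N ->
  (forall c, (c < n)%N -> (sig c <= sig c.+1 <= (sig c).+1)%N) ->
  \sum_(c < n) Xi (q (sig c)) (q (sig c.+1)) =
  \sum_(j < sig n) Xi (q j) (q j.+1).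
Proof.
move=> Xi0 s0; elim: n => [|n IH] H; first by rewrite s0 !big_ord0.
rewrite big_ord_recr /= IH; last by move=> c cn; apply: H; apply: ltnW.
have /andP[] := H n (ltnSn n).
rewrite leq_eqVlt => /predU1P[<- _|h1 h2]; first by rewrite Xi0 addr0.
have -> : sig n.+1 = (sig n).+1 by apply/eqP; rewrite eqn_leq h1 h2.
by rewrite big_ord_recr.
Qed.

Lemma geometric_sum_le (R : realType) (th : R) n : 0 <= th -> th < 1 ->
  \sum_(k < n) th ^+ k <= (1 - th)^-1.
Proof.
move=> th0 th1; have d0 : 0 < 1 - th by rewrite subr_gt0.
rewrite -div1r ler_pdivlMr //.
have -> : (\sum_(k < n) th ^+ k) * (1 - th) = 1 - th ^+ n.
  elim: n => [|n IH]; first by rewrite big_ord0 mul0r expr0 subrr.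
  by rewrite big_ord_recr /= mulrDl IH exprS; ring.
by rewrite gerBl exprn_ge0.
Qed.

Section DyadicSewing.
Context {R : realType} {V : normedModType R}.
Variable Xi : R -> R -> V.

(** The change in a Riemann sum caused by inserting [u] between [s] and [t],
    up to sign. *)
Definition defect (s u t : R) : V := Xi s t - Xi s u - Xi u t.

(** The clock [F t = #{i | p_{i+1} <= t} + w t] has values in [[i, i + 1)] on the
    [i]-th interval of the coarse partition [p]. At level [k] keep of the fine
    partition [q] only the first point of each cell [[c/2^k, (c+1)/2^k)] of the
    clock. Level 0 is [p], a large level is [q], and passing from one level to the
    next inserts at most one point per cell. If the point [u] inserted in a cell
    is not the starting point of the next one, then it lies in the same cell as
    the first point [s], so that [w u - w s <= 2^-k]. Hence the errors of
    the levels form a geometric series. *)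
Lemma dyadic_sewing (a b delta B th : R) (w : R -> R) :
  0 <= th -> th < 1 -> (forall s, Xi s s = 0) ->
  (forall s t, a <= s -> s < t -> t <= b -> w s < w t) ->
  (forall t, a <= t <= b -> 0 <= w t < 1) ->
  (forall k n tau, chain a b n.*2 tau ->
     (forall c, (c < n)%N -> tau c.*2.+1 = tau c.*2.+2 \/
        w (tau c.*2.+1) - w (tau c.*2) <= 2^-1 ^+ k) ->
     (forall c, (c < n)%N -> tau c.*2.+2 - tau c.*2.+1 < delta) ->
     `|\sum_(c < n) defect (tau c.*2) (tau c.*2.+1) (tau c.*2.+2)|
       <= B * th ^+ k) ->
  forall n p n' q,
    p 0%N = a -> p n = b -> (forall i, (i < n)%N -> p i < p i.+1) ->
    q 0%N = a -> q n' = b -> (forall i, (i < n')%N -> q i < q i.+1) ->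
    (forall i, (i <= n)%N -> exists2 j, (j <= n')%N & p i = q j) ->
    (forall i, (i < n)%N -> p i.+1 - p i < delta) ->
  `|\sum_(i < n') Xi (q i) (q i.+1) - \sum_(i < n) Xi (p i) (p i.+1)|
    <= B / (1 - th).
Proof.
move=> th0 th1 Xi0 w_incr w01 bound n p n' q p0 pn p_incr q0 qn q_incr pq pmesh.
(* the clock: its integer part locates the coarse interval *)
pose cnt t : nat := (\sum_(i < n) (p i.+1 <= t)%R)%N.
pose F t := (cnt t)%:R + w t.
have q_lt := steps_lt q_incr; have p_lt := steps_lt p_incr.
have q_le := steps_le (fun i h => ltW (q_incr i h)).
have p_le := steps_le (fun i h => ltW (p_incr i h)).
have q_ab i : (i <= n')%N -> a <= q i <= b.
  by move=> h; rewrite -q0 -qn !q_le.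
have sum_lt m : (m <= n)%N -> (\sum_(i < n) (i < m)%N = m)%N.
  move=> mn; rewrite -(big_mkord xpredT (fun i => nat_of_bool (i < m)%N)).
  rewrite (big_cat_nat (n := m)) //= big_nat.
  rewrite (eq_bigr (fun=> 1%N)); last by move=> i /andP[_ ->].
  rewrite -big_nat sum_nat_const_nat subn0 muln1 big_nat big1 ?addn0 //.
  by move=> i /andP[mi _]; rewrite ltnNge mi.
have F_ge m t : (m <= n)%N -> a <= t <= b -> p m <= t -> m%:R <= F t.
  move=> mn tab pmt; have /andP[w0 _] := w01 t tab.
  apply: (@le_trans _ _ (cnt t)%:R); last by rewrite lerDl.
  rewrite ler_nat -[X in (X <= _)%N](sum_lt m mn) /cnt; apply: leq_sum => i _.
  case: ltnP => //= im.
  by rewrite (le_trans _ pmt) // p_le.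
have F_lt m t : (m <= n)%N -> a <= t <= b -> t < p m -> F t < m%:R.
  move=> mn tab pmt; have /andP[_ w1] := w01 t tab.
  case: m mn pmt => [|m] mn pmt.
    by move: tab; rewrite -p0 => /andP[h _]; move: pmt; rewrite ltNge h.
  rewrite -natr1; apply: ler_ltD => //.
  rewrite ler_nat -[X in (_ <= X)%N](sum_lt m (ltnW mn)) /cnt; apply: leq_sum => i _.
  case: (ltnP i m) => [_|im]; first exact: leq_b1.
  rewrite leqn0 eqb0 -ltNge (lt_le_trans pmt) // p_le // ltnS //.
have F_incr s t : a <= s -> s < t -> t <= b -> F s < F t.
  move=> as_ st tb; apply: ler_ltD; last exact: w_incr.
  rewrite ler_nat; apply: leq_sum => i _.
  by case: (boolP (p i.+1 <= s)%R) => //= h; rewrite (le_trans h (ltW st)).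
pose f j := F (q j).
pose sig y := first_above f n' y.
pose tau k c := q (sig (c%:R / 2 ^+ k)).
have tau_double k c : tau k.+1 c.*2 = tau k c.
  rewrite /tau; congr (q (sig _)); rewrite -mul2n natrM exprS.
  by field; rewrite expf_neq0 // pnatr_eq0.
have div_le k (c c' : nat) : (c <= c')%N -> c%:R / 2 ^+ k <= c'%:R / 2 ^+ k :> R.
  by move=> cc; rewrite ler_wpM2r ?ler_nat // invr_ge0 exprn_ge0.
have tau_le k c c' : (c <= c')%N -> tau k c <= tau k c'.
  move=> cc; apply: q_le; last exact: first_above_le.
  exact/first_above_mono/div_le.
have tau0 i : (i <= n)%N -> q (sig i%:R) = p i.
  move=> i_n; have [j jn pj] := pq i i_n.
  rewrite pj; congr q; apply: first_above_eq => // [j' j'j|jn'].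
    apply: F_lt => //; first by apply: q_ab; apply: leq_trans (ltnW j'j) jn.
    by rewrite pj q_lt.
  by apply: F_ge => //; [exact: q_ab | rewrite pj].
pose S k := \sum_(c < n * 2 ^ k) Xi (tau k c) (tau k c.+1).
have S0 : S 0%N = \sum_(i < n) Xi (p i) (p i.+1).
  rewrite /S expn0 muln1; apply: eq_bigr => i _.
  by rewrite /tau expr0 !divr1 !tau0 // ltnW.
have pow_gt0 k : 0 < 2 ^+ k :> R by rewrite exprn_gt0.
have Sstep k : `|S k.+1 - S k| <= B * th ^+ k.
  rewrite -normrN opprB.
  have -> : S k - S k.+1 = \sum_(c < n * 2 ^ k)
      defect (tau k.+1 c.*2) (tau k.+1 c.*2.+1) (tau k.+1 c.*2.+2).
    have e : (n * 2 ^ k.+1 = (n * 2 ^ k).*2)%N by rewrite expnS mulnCA mul2n.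
    rewrite /S e (sum_double (fun c => Xi (tau k.+1 c) (tau k.+1 c.+1))) -sumrB.
    apply: eq_bigr => c _.
    by rewrite /defect -doubleS !tau_double opprD addrA.
  apply: bound => [|c cn|c cn].
  - split=> [i _|i _]; first exact: tau_le.
    by apply: q_ab; apply: first_above_le.
  - set u := sig (c.*2.+1%:R / 2 ^+ k.+1); set t := sig (c.*2.+2%:R / 2 ^+ k.+1).
    have : (u <= t)%N by apply/first_above_mono/div_le.
    rewrite leq_eqVlt => /predU1P[ut|ut]; first by left; rewrite /tau -/u -/t ut.
    right; have h1 := first_above_before ut.
    rewrite tau_double /tau; set s := sig (c%:R / 2 ^+ k).
    have su : (s <= u)%N.
      have := tau_double k c; rewrite /s /u => _.
      apply: first_above_mono; rewrite ler_pdivrMr // exprS.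
      rewrite -mul2n -natr1 natrM.
      have -> : (2 * c%:R + 1) / (2 * 2 ^+ k) * 2 ^+ k = c%:R + 2^-1 :> R.
        by field; rewrite gt_eqF.
      by rewrite lerDl.
    have un' : (u < n')%N by apply: leq_trans ut (first_above_le _ _ _).
    have h2 : c%:R / 2 ^+ k <= f s by apply: first_above_at; apply: leq_ltn_trans su un'.
    rewrite -doubleS -mul2n natrM exprS -mulf_div divff // mul1r in h1.
    have cc : ((cnt (q s))%:R <= (cnt (q u))%:R :> R).
      rewrite ler_nat; apply: leq_sum => i _.
      case: (boolP (p i.+1 <= q s)%R) => //= h; rewrite (le_trans h) // q_le //.
      exact: ltnW.
    have : f u - f s <= 2^-1 ^+ k.
      rewrite exprVn lerBlDr (le_trans (ltW h1)) // -natr1 mulrDl mul1r addrC.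
      by rewrite lerD2l.
    by move=> h; apply: le_trans h; rewrite /f /F opprD addrACA lerDr subr_ge0.
  - pose m := (c %/ 2 ^ k)%N.
    have pk : (0 < 2 ^ k)%N by rewrite expn_gt0.
    have mn : (m < n)%N by rewrite ltn_divLR.
    apply: le_lt_trans (pmesh m mn); rewrite -doubleS tau_double.
    apply: lerB.
      rewrite -(tau0 m.+1) //; apply: q_le; last exact: first_above_le.
      apply: first_above_mono; rewrite ler_pdivrMr // -natrX -natrM ler_nat.
      by rewrite ltn_ceil.
    apply: (@le_trans _ _ (tau k.+1 c.*2)); last exact: tau_le.
    rewrite tau_double -(tau0 m) ?(ltnW mn) //.
    apply: q_le; last exact: first_above_le.
    apply: first_above_mono; rewrite ler_pdivlMr // -natrX -natrM ler_nat.
    exact: leq_trunc_div.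
have SN N : `|S N - S 0%N| <= B * \sum_(k < N) th ^+ k.
  elim: N => [|N IH]; first by rewrite subrr normr0 big_ord0 mulr0.
  rewrite big_ord_recr /= mulrDr -(subrKA (S N)).
  by rewrite addrC (le_trans (ler_normD _ _)) // lerD.
(* at level N the cells are shorter than the gaps between clock values *)
have [N HN] : exists N, forall j, (j < n')%N -> 2^-1 ^+ N <= f j.+1 - f j.
  have : forall m, (m <= n')%N ->
      exists N, forall j, (j < m)%N -> 2^-1 ^+ N <= f j.+1 - f j.
    elim=> [|m IH] mn; first by exists 0%N.
    have [N HN] := IH (ltnW mn).
    have gap : 0 < f m.+1 - f m.
      rewrite subr_gt0; apply: F_incr; [|exact: q_incr|].
        by have /andP[] := q_ab m (ltnW mn).
      by have /andP[] := q_ab m.+1 mn.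
    have [N' HN'] : exists N', 2^-1 ^+ N' <= f m.+1 - f m.
      have [N' /ltW HN'] : exists N', 2^-1 ^+ N' < f m.+1 - f m.
        have c0 : (2^-1 : R) ^+ k @[k --> \oo] --> (0 : R).
          by apply: cvg_expr; rewrite ger0_norm // invf_lt1 // ltr1n.
        have /(_ _ _ gap) := cvgr_lt _ c0.
        by case=> N' _ H; exists N'; exact: (H N' (leqnn _)).
      by exists N'.
    exists (maxn N N') => j; rewrite ltnS leq_eqVlt => /predU1P[->|jm].
      apply: le_trans HN'; apply: ler_wiXn2l; rewrite ?leq_maxr //.
      by rewrite invf_le1 // ler1n.
    apply: le_trans (HN j jm); apply: ler_wiXn2l; rewrite ?leq_maxl //.
    by rewrite invf_le1 // ler1n.
  by apply.
have SNq : S N = \sum_(i < n') Xi (q i) (q i.+1).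
  have sn : sig ((n * 2 ^ N)%N%:R / 2 ^+ N) = n'.
    rewrite natrM natrX mulfK ?gt_eqF //; apply: first_above_eq => // [j jn'|].
      apply: F_lt => //; first exact: q_ab (ltnW jn').
      by rewrite pn -qn q_lt.
    by rewrite ltnn.
  pose sg c := sig (c%:R / 2 ^+ N).
  have := @sum_walk _ V Xi q sg (n * 2 ^ N) Xi0.
  have -> : sg (n * 2 ^ N)%N = n' by exact: sn.
  move=> <- //.
    apply: first_above_eq => // _; rewrite mul0r.
    by apply: (F_ge 0%N) => //; [exact: q_ab | rewrite p0 q0].
  move=> c cn; rewrite first_above_mono ?div_le //= leqNgt.
  apply/negP => h; have h1 := first_above_before h.
  have s1 : ((sg c).+1 < n')%N by apply: leq_trans h (first_above_le _ _ _).
  have h2 : c%:R / 2 ^+ N <= f (sg c) by apply: first_above_at; apply: ltnW.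
  have := HN (sg c) (ltnW s1).
  move: h1; rewrite exprVn -natr1 mulrDl mul1r; move: h2; rewrite /sg; lra.
rewrite -SNq -S0; apply: le_trans (SN N) _.
apply: ler_wpM2l; last exact: geometric_sum_le.
have := bound 0%N 0%N (fun=> a); rewrite big_ord0 normr0 expr0 mulr1; apply=> //.
by split=> // i _; rewrite lexx -p0 -pn p_le.
Qed.

End DyadicSewing.

(** * Superadditive variation along chains *)
Section Variation.
Context {R : realType}.
Implicit Types (a b s t : R) (u v : nat -> R) (phi : R -> R -> R).

Lemma chain_widen a b s t n u : a <= s -> t <= b ->
  chain s t n u -> chain a b n u.
Proof.
move=> as_ tb [H1 H2]; split=> // i /H2/andP[h1 h2].
by rewrite (le_trans as_ h1) (le_trans h2 tb).
Qed.

Lemma chain_cst a b n : a <= b -> chain a b n (fun=> a).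
Proof. by move=> ab; split=> // i _; rewrite lexx. Qed.

Lemma chain_pair a b s t : a <= s -> s <= t -> t <= b ->
  chain a b 1 (fun i => if i is 0%N then s else t).
Proof.
move=> as_ st tb; split=> [[|]//|[|i] _]; first by rewrite as_ (le_trans st).
by rewrite tb (le_trans as_).
Qed.

Definition glue (n : nat) u v (i : nat) : R :=
  if (i <= n)%N then u i else v (i - n.+1)%N.

Lemma chain_glue a b c n u m v : a <= c -> c <= b ->
  chain a c n u -> chain c b m v -> chain a b (n.+1 + m) (glue n u v).
Proof.
move=> ac cb [u1 u2] [v1 v2]; split=> i; rewrite /glue.
  case: (ltngtP i n) => [h|h|->] ile.
  - exact: u1.
  - rewrite subSn // ?v1 //; move: ile h; lia.
  - rewrite subnn; have /andP[_ h] := u2 n (leqnn _).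
    by have /andP[h' _] := v2 0%N (leq0n _); apply: le_trans h h'.
move=> ile; case: (leqP i n) => h.
  by have /andP[-> h2] := u2 i h; rewrite (le_trans h2 cb).
have /andP[h1 ->] : c <= v (i - n.+1)%N <= b by apply: v2; move: ile h; lia.
by rewrite (le_trans ac h1).
Qed.

Lemma sum_glue phi n u m v :
  \sum_(i < n.+1 + m) phi (glue n u v i) (glue n u v i.+1) =
  \sum_(i < n) phi (u i) (u i.+1) + phi (u n) (v 0%N) +
  \sum_(i < m) phi (v i) (v i.+1).
Proof.
rewrite big_split_ord /= big_ord_recr /= /glue leqnn ltnn subnn.
congr (_ + _ + _); apply: eq_bigr => i _ /=.
  by rewrite ltn_ord ltnW.
have -> : (n.+1 + i <= n)%N = false by lia.
have -> : (n.+1 + i < n)%N = false by lia.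
by rewrite addKn -addnS addKn.
Qed.

Definition chain_sums phi s t : set R :=
  [set x | exists n, exists2 u, chain s t n u &
     x = \sum_(i < n) phi (u i) (u i.+1)].

(** For [phi s t = |f t - f s| ^ p] this is the [p]-th power of the
    [p]-variation of [f] on [[s, t]]. *)
Definition vsup phi s t : R := sup (chain_sums phi s t).

Section Superadditivity.
Variables (a b M : R) (phi : R -> R -> R).
Hypothesis phi_ge0 : forall s t, 0 <= phi s t.
Hypothesis phi_bound : forall n u, chain a b n u ->
  \sum_(i < n) phi (u i) (u i.+1) <= M.

Lemma vsup_ub s t n u : a <= s -> t <= b -> chain s t n u ->
  \sum_(i < n) phi (u i) (u i.+1) <= vsup phi s t.
Proof.
move=> as_ tb cu; apply: ub_le_sup; last by exists n, u.
by exists M => _ [m [v cv ->]]; apply/phi_bound/(chain_widen as_ tb).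
Qed.

Lemma vsup_le s t x : s <= t ->
  (forall n u, chain s t n u -> \sum_(i < n) phi (u i) (u i.+1) <= x) ->
  vsup phi s t <= x.
Proof.
move=> st H; apply: ge_sup => [|_ [n [u cu ->]]]; last exact: H.
by exists 0, 0%N, (fun=> s); [exact: chain_cst | rewrite big_ord0].
Qed.

Lemma vsup_ge s t : a <= s -> s <= t -> t <= b -> phi s t <= vsup phi s t.
Proof.
move=> as_ st tb; have := vsup_ub as_ tb (chain_pair (lexx s) st (lexx t)).
by rewrite big_ord1.
Qed.

Lemma vsup_ge0 s t : a <= s -> s <= t -> t <= b -> 0 <= vsup phi s t.
Proof. by move=> ? ? ?; apply: le_trans (vsup_ge _ _ _). Qed.

Lemma vsup_leM s t : a <= s -> s <= t -> t <= b -> vsup phi s t <= M.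
Proof.
by move=> as_ st tb; apply: vsup_le => // n u /(chain_widen as_ tb)/phi_bound.
Qed.

(** Two chains on adjacent intervals concatenate, at the cost of one more term,
    which is nonnegative. *)
Lemma vsup_superadditive s t z : a <= s -> s <= t -> t <= z -> z <= b ->
  vsup phi s t + vsup phi t z <= vsup phi s z.
Proof.
move=> as_ st tz zb; rewrite -lerBrDr; apply: vsup_le => // n u cu.
rewrite lerBrDr addrC -lerBrDr; apply: vsup_le => // m v cv.
rewrite lerBrDr addrC.
have := vsup_ub as_ zb (chain_glue st tz cu cv).
by apply: le_trans; rewrite sum_glue lerD2r lerDl.
Qed.

Lemma sum_vsup_le n u : chain a b n u ->
  \sum_(i < n) vsup phi (u i) (u i.+1) <= M.
Proof.
case=> u1 u2; have /andP[au0 u0b] := u2 0%N (leq0n _).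
have /andP[aun unb] := u2 n (leqnn _).
apply: (@le_trans _ _ (vsup phi (u 0%N) (u n))); last first.
  by apply: vsup_leM => //; apply: steps_le u1 _ _ _ _.
elim: n u1 u2 {aun} unb => [|n IH] u1 u2 unb.
  by rewrite big_ord0 vsup_ge0.
have /andP[aun unb'] := u2 n (leqnSn _).
rewrite big_ord_recr /=; apply: (@le_trans _ _ (vsup phi (u 0%N) (u n) +
    vsup phi (u n) (u n.+1))).
  rewrite lerD2r; apply: IH => // i ni; first by apply: u1; apply: ltnW.
  by apply: u2; apply: leqW.
apply: vsup_superadditive => //; last exact: u1.
by apply: (@steps_le _ n.+1) => //.
Qed.

End Superadditivity.

End Variation.

Section PathSums.
Context {R : realType}.

Definition path_sum (V : nmodType) (Xi : R -> R -> V) (x : R) (s : seq R) : V :=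
  \sum_(i < size s) Xi (pnt x s i) (pnt x s i.+1).

Lemma pnt_last (x : R) s : pnt x s (size s) = last x s.
Proof. by rewrite /pnt nth_last. Qed.

Lemma pnt_rcons (x : R) s y i : (i <= size s)%N ->
  pnt x (rcons s y) i = pnt x s i.
Proof. by move=> h; rewrite /pnt -rcons_cons nth_rcons /= ltnS h. Qed.

Lemma path_sum_rcons (V : nmodType) (Xi : R -> R -> V) x s y :
  path_sum Xi x (rcons s y) = path_sum Xi x s + Xi (last x s) y.
Proof.
rewrite /path_sum size_rcons big_ord_recr /=; congr (_ + Xi _ _).
- by apply: eq_bigr => i _; rewrite !pnt_rcons // ltnW.
- by rewrite pnt_rcons // pnt_last.
- by rewrite -(size_rcons s y) pnt_last last_rcons.
Qed.

Lemma path_sum_cons (V : nmodType) (Xi : R -> R -> V) x y s :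
  path_sum Xi x (y :: s) = Xi x y + path_sum Xi y s.
Proof.
rewrite /path_sum /= big_ord_recl; congr (_ + _); apply: eq_bigr => i _.
rewrite /pnt lift0; congr (Xi _ _); apply: set_nth_default => /=; have := ltn_ord i; lia.
Qed.

(** The strictly increasing path is the same for all [phi], so that the lemma
    can be applied in each variable of a double sum separately. *)
Lemma chain_path (n : nat) (u : nat -> R) :
  (forall i, (i < n)%N -> u i <= u i.+1) ->
  exists s, [/\ path <%R (u 0%N) s, last (u 0%N) s = u n,
    (forall y, y \in s -> exists2 i, (i <= n)%N & y = u i) &
    forall phi : R -> R -> R, (forall x, phi x x = 0) ->
      \sum_(i < n) phi (u i) (u i.+1) = path_sum phi (u 0%N) s].
Proof.
elim: n => [|n IH] u_le.
  by exists [::]; split=> // phi _; rewrite /path_sum !big_ord0.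
have [s [ps ls sin sums]] := IH (fun i h => u_le i (leqW h)).
have := u_le n (ltnSn _); rewrite le_eqVlt => /predU1P[e|lt].
  exists s; split=> //; first by rewrite ls.
    by move=> y /sin[i ile ->]; exists i => //; apply: leqW.
  by move=> phi phi0; rewrite big_ord_recr /= -e phi0 addr0 sums.
exists (rcons s (u n.+1)); split.
- by rewrite rcons_path ps ls.
- by rewrite last_rcons.
- move=> y; rewrite mem_rcons inE => /predU1P[->|/sin[i ile ->]].
    by exists n.+1.
  by exists i => //; apply: leqW.
- by move=> phi phi0; rewrite big_ord_recr /= path_sum_rcons sums // ls.
Qed.

Lemma chain_itv_partition (T : R) n u : chain 0 T n u ->
  exists2 r, itv_partition 0 T r & forall phi : R -> R -> R,
    (forall s t, 0 <= phi s t) -> (forall s, phi s s = 0) ->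
    \sum_(i < n) phi (u i) (u i.+1) <= path_sum phi 0 r.
Proof.
case=> u1 u2; have [s [ps ls _ sums]] := chain_path u1.
have [r0 [pr lr suml]] : exists r0, [/\ path <%R 0 r0, last 0 r0 = u n &
    forall phi : R -> R -> R,
    (forall s t, 0 <= phi s t) -> (forall s, phi s s = 0) ->
    \sum_(i < n) phi (u i) (u i.+1) <= path_sum phi 0 r0].
  have /andP[] := u2 0%N (leq0n _); rewrite le_eqVlt => /predU1P[e|lt] _.
    rewrite -e in ps ls sums.
    by exists s; split=> // phi phi0 phixx; rewrite sums.
  exists (u 0%N :: s); split=> //=; first by rewrite lt.
  by move=> phi phi0 phixx; rewrite path_sum_cons -sums // lerDr.
have /andP[_] := u2 n (leqnn _); rewrite le_eqVlt => /predU1P[e|lt].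
  by exists r0 => //; split=> //; rewrite lr e.
exists (rcons r0 T).
  by split; rewrite ?rcons_path ?pr ?lr ?last_rcons //=.
move=> phi phi0 phixx; rewrite path_sum_rcons.
by apply: le_trans (suml _ phi0 phixx) _; rewrite lerDl.
Qed.

End PathSums.

(** * Grid variation of kernels and sewing in Hilbert spaces *)
Section GridVariation.
Context {R : realType}.
Implicit Types (a b q : R) (G : R -> R -> R).

Definition grid_sum q G n (u : nat -> R) m (v : nat -> R) : R :=
  \sum_(i < n) \sum_(j < m)
    `|rect_incr G (u i) (u i.+1) (v j) (v j.+1)| `^ q.

Definition grid_var q a b G M : Prop := forall n u m v,
  chain a b n u -> chain a b m v -> grid_sum q G n u m v <= M.

Lemma grid_var_ge0 q a b G M : a <= b -> grid_var q a b G M -> 0 <= M.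
Proof.
move=> ab /(_ 0%N (fun=> a) 0%N (fun=> a) (chain_cst _ ab) (chain_cst _ ab)).
by rewrite /grid_sum big_ord0.
Qed.

Lemma rect_incr_diagl G x c d : rect_incr G x x c d = 0.
Proof. by rewrite /rect_incr; ring. Qed.

Lemma rect_incr_diagr G a b x : rect_incr G a b x x = 0.
Proof. by rewrite /rect_incr; ring. Qed.

Lemma grid_var_finite_2D q T G : 0 < q -> finite_2D_var q T G ->
  exists M, grid_var q 0 T G M.
Proof.
move=> q0 [M HM]; exists M => n u m v cu cv; rewrite /grid_sum.
have p0 : (0 : R) `^ q = 0 by rewrite powR0 ?gt_eqF.
have [r pr Hr] := chain_itv_partition cu.
have [r' pr' Hr'] := chain_itv_partition cv.
apply: le_trans (HM r r' pr pr').
apply: le_trans (Hr (fun x y => \sum_(j < m)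
    `|rect_incr G x y (v j) (v j.+1)| `^ q) _ _) _ => [s t|s|].
- by apply: sumr_ge0 => *; apply: powR_ge0.
- by rewrite big1 // => j _; rewrite rect_incr_diagl normr0.
apply: ler_sum => i _.
apply: (Hr' (fun x y => `|rect_incr G (pnt 0 r i) (pnt 0 r i.+1) x y| `^ q)).
  by move=> *; apply: powR_ge0.
by move=> s; rewrite rect_incr_diagr normr0.
Qed.

Lemma even_sum_le (F : nat -> R) n : (forall i, 0 <= F i) ->
  \sum_(c < n) F c.*2 <= \sum_(i < n.*2) F i.
Proof. by move=> F0; rewrite sum_double; apply: ler_sum => i _; rewrite lerDl. Qed.

Lemma odd_sum_le (F : nat -> R) n : (forall i, 0 <= F i) ->
  \sum_(c < n) F c.*2.+1 <= \sum_(i < n.*2) F i.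
Proof. by move=> F0; rewrite sum_double; apply: ler_sum => i _; rewrite lerDr. Qed.

Lemma grid_sum_even q G n u :
  \sum_(c < n) \sum_(c' < n) `|rect_incr G (u c.*2) (u c.*2.+1)
     (u c'.*2) (u c'.*2.+1)| `^ q <= grid_sum q G n.*2 u n.*2 u.
Proof.
rewrite /grid_sum.
apply: le_trans (even_sum_le (F := fun i => \sum_(j < n.*2)
  `|rect_incr G (u i) (u i.+1) (u j) (u j.+1)| `^ q) n _) => [|i].
  apply: ler_sum => c _; apply: (even_sum_le (F := fun j =>
    `|rect_incr G (u c.*2) (u c.*2.+1) (u j) (u j.+1)| `^ q)) => j.
  exact: powR_ge0.
by apply: sumr_ge0 => *; apply: powR_ge0.
Qed.

Lemma grid_sum_odd q G n u :
  \sum_(c < n) \sum_(c' < n) `|rect_incr G (u c.*2.+1) (u c.*2.+2)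
     (u c'.*2.+1) (u c'.*2.+2)| `^ q <= grid_sum q G n.*2 u n.*2 u.
Proof.
rewrite /grid_sum.
apply: le_trans (odd_sum_le (F := fun i => \sum_(j < n.*2)
  `|rect_incr G (u i) (u i.+1) (u j) (u j.+1)| `^ q) n _) => [|i].
  apply: ler_sum => c _; apply: (odd_sum_le (F := fun j =>
    `|rect_incr G (u c.*2.+1) (u c.*2.+2) (u j) (u j.+1)| `^ q)) => j.
  exact: powR_ge0.
by apply: sumr_ge0 => *; apply: powR_ge0.
Qed.

(** What is used of the positivity of a Gram kernel: on rectangles it is
    dominated by its values on the diagonal squares. *)
Definition cauchy_schwarz (a b : R) (G : R -> R -> R) : Prop :=
  forall s u s' u', a <= s -> s <= u -> u <= b ->
    a <= s' -> s' <= u' -> u' <= b ->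
    `|rect_incr G s u s' u'| <=
      Num.max `|rect_incr G s u s u| `|rect_incr G s' u' s' u'|.

(** The form that the squared norm of a batch of defects takes for the germ
    [Xi s t = Z_s (x) (x_t - x_s)], when [G] and [K] are the Gram kernels of
    [Z] and [x]. *)
Definition defect_bound (a b : R) (V : normedModType R) (Xi : R -> R -> V)
    (G K : R -> R -> R) : Prop :=
  forall n tau, chain a b n.*2 tau ->
     `|\sum_(c < n) defect Xi (tau c.*2) (tau c.*2.+1) (tau c.*2.+2)| ^+ 2 <=
     \sum_(c < n) \sum_(c' < n)
       `|rect_incr G (tau c.*2) (tau c.*2.+1) (tau c'.*2) (tau c'.*2.+1)| *
       `|rect_incr K (tau c.*2.+1) (tau c.*2.+2)
                     (tau c'.*2.+1) (tau c'.*2.+2)|.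

End GridVariation.

Section HilbertSewing.
Context {R : realType}.

Lemma geometric_mean_le (A B th : R) : 0 <= A -> 0 <= B -> 0 <= th <= 1 ->
  A `^ th * B `^ (1 - th) <= A + B.
Proof.
move=> A0 B0 /andP[th0 th1]; have th1' : 0 <= 1 - th by rewrite subr_ge0.
apply: (@le_trans _ _ ((A + B) `^ th * (A + B) `^ (1 - th))).
  apply: ler_pM; rewrite ?powR_ge0 //; apply: ge0_ler_powR => //;
    by rewrite ?nnegrE ?addr_ge0 // ?lerDl ?lerDr.
have e1 : th + (1 - th) = 1 by ring.
by rewrite -powRD e1 ?oner_eq0 // powRr1 // addr_ge0.
Qed.

Variables (q rho : R).
Hypotheses (q_gt0 : 0 < q) (rho_gt0 : 0 < rho) (q_rho : 1 < q^-1 + rho^-1).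

(** The room that [1/q + 1/rho > 1] leaves in Hoelder's inequality: the exponent
    to which smallness is gained in [young_product]. *)
Definition excess : R := 1 - (q^-1 + rho^-1)^-1.

Lemma excess_gt0 : 0 < excess.
Proof. by rewrite subr_gt0 invf_lt1 // (lt_trans ltr01). Qed.

Lemma excess_lt1 : excess < 1.
Proof. by rewrite ltrBlDl ltrDr invr_gt0 (lt_trans ltr01). Qed.

(** Write [g = g^excess g^(1-excess)], and likewise for [k / m]. The first
    factors are small; the product of the others is a weighted geometric mean
    of [g^q] and [(k / m)^rho], because [(1 - excess) (1/q + 1/rho) = 1]. In this
    form Hoelder's inequality becomes a bound on each term of a sum. The alternative
    [k = 0] covers the cells whose successor is empty. *)
Lemma young_product (g k e m lam : R) :
  0 <= g -> 0 <= k -> 0 <= e -> 0 <= m -> 0 <= lam ->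
  k = 0 \/ g `^ q <= lam -> k <= e * m ->
  g * k <= lam `^ (excess / q) * e `^ excess * m * (g `^ q + (k / m) `^ rho).
Proof.
move=> g0 k0 e0 m0 lam0.
have rhs0 : 0 <= lam `^ (excess / q) * e `^ excess * m * (g `^ q + (k / m) `^ rho).
  by rewrite !mulr_ge0 ?addr_ge0 ?powR_ge0.
case=> [k_0 _|glam kem]; first by rewrite [X in _ * X]k_0 mulr0.
move: k0; rewrite le_eqVlt => /predU1P[k0|k0].
  by rewrite -[X in _ * X]k0 mulr0.
move: m0; rewrite le_eqVlt => /predU1P[m0|m0].
  by move: (lt_le_trans k0 kem); rewrite -m0 mulr0 ltxx.
have al0 := excess_gt0; have al1 := excess_lt1.
pose x := k / m; have x0 : 0 <= x by rewrite divr_ge0 // ltW.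
have xe : x <= e by rewrite ler_pdivrMr.
have -> : g * k = m * (g * x) by rewrite /x; field; rewrite gt_eqF.
rewrite (mulrC _ m) -mulrA ler_wpM2l ?(ltW m0) //.
have split_pow y : 0 <= y -> y = y `^ excess * y `^ (1 - excess).
  have e1 : excess + (1 - excess) = 1 by rewrite addrC subrK.
  by move=> y0; rewrite -powRD e1 ?oner_eq0 // powRr1.
rewrite {1}(split_pow g g0) {1}(split_pow x x0).
rewrite mulrACA; apply: ler_pM; rewrite ?mulr_ge0 ?powR_ge0 //.
  apply: ler_pM; rewrite ?powR_ge0 //.
    rewrite [X in _ `^ X <= _](_ : excess = q * (excess / q)); last first.
      by field; rewrite gt_eqF.
    by rewrite powRrM; apply: ge0_ler_powR; rewrite ?nnegrE ?powR_ge0 // divr_ge0 // ltW.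
  by apply: ge0_ler_powR; rewrite ?nnegrE // ltW.
pose th := (1 - excess) / q.
have sum0 : q^-1 + rho^-1 != 0 by rewrite gt_eqF // (lt_trans ltr01).
have e1 : 1 - excess = q * th by rewrite /th; field; rewrite gt_eqF.
have e2 : 1 - excess = rho * (1 - th).
  rewrite /th /excess opprB addrC subrK; move: sum0.
  have -> : q^-1 + rho^-1 = (q + rho) / (q * rho).
    by field; rewrite !gt_eqF.
  by rewrite mulf_eq0 => /norP[h _]; field; rewrite !gt_eqF ?addr_gt0.
rewrite {1}e1 e2 (powRrM g) (powRrM x); apply: geometric_mean_le; rewrite ?powR_ge0 //.
have t1 : 0 <= 1 - excess by rewrite subr_ge0 ltW.
apply/andP; split; first by rewrite divr_ge0 // ltW.
by rewrite -subr_ge0 -(pmulr_rge0 _ rho_gt0) -e2.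
Qed.

Definition sewing_ratio : R := Num.sqrt (2^-1 `^ (excess / q)).

Definition sewing_constant (W : R) : R :=
  Num.sqrt (W `^ (excess / q) * (W + 1)) / (1 - sewing_ratio).

Lemma sewing_ratio_lt1 : sewing_ratio < 1.
Proof.
rewrite /sewing_ratio -[ltRHS]sqrtr1 ltr_sqrt //.
rewrite -[ltRHS](_ : (1 : R) `^ (excess / q) = 1); last by rewrite powR1.
apply: gt0_ltr_powR; rewrite ?nnegrE // ?divr_gt0 ?excess_gt0 //.
by rewrite invf_lt1 // ltr1n.
Qed.

(** The clock is the [q]-variation of [G] along the diagonal, which makes the
    increments of [G] small at high levels. The bound is homogeneous in the
    size [m] of [K], which localises it to small intervals, and small with [e],
    which gives convergence as the mesh tends to 0. *)
Lemma hilbert_sewing (V : normedModType R) (Xi : R -> R -> V)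
    (G K : R -> R -> R) (a b Mg m e delta W : R) :
  a <= b -> 0 <= m -> 0 <= e -> (forall s, Xi s s = 0) ->
  cauchy_schwarz a b G ->
  grid_var q a b G Mg -> grid_var rho a b K (m `^ rho) ->
  (forall u t u' t', a <= u -> u <= t -> t <= b ->
     a <= u' -> u' <= t' -> t' <= b -> t - u < delta -> t' - u' < delta ->
     `|rect_incr K u t u' t'| <= e * m) ->
  defect_bound a b Xi G K ->
  Mg + (b - a) < W ->
  forall n p n' r,
    p 0%N = a -> p n = b -> (forall i, (i < n)%N -> p i < p i.+1) ->
    r 0%N = a -> r n' = b -> (forall i, (i < n')%N -> r i < r i.+1) ->
    (forall i, (i <= n)%N -> exists2 j, (j <= n')%N & p i = r j) ->
    (forall i, (i < n)%N -> p i.+1 - p i < delta) ->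
  `|\sum_(i < n') Xi (r i) (r i.+1) - \sum_(i < n) Xi (p i) (p i.+1)|
    <= sewing_constant W * Num.sqrt (e `^ excess * m).
Proof.
move=> ab m0 e0 Xi0 cs Gvar Kvar Kmesh Dbound MgW.
have Mg0 := grid_var_ge0 ab Gvar.
have W0 : 0 < W by apply: le_lt_trans MgW; rewrite addr_ge0 // subr_ge0.
pose phi s t := `|rect_incr G s t s t| `^ q.
have phi0 s t : 0 <= phi s t by apply: powR_ge0.
have phiM n u : chain a b n u -> \sum_(i < n) phi (u i) (u i.+1) <= Mg.
  move=> cu; apply: le_trans (Gvar n u n u cu cu); apply: ler_sum => i _.
  by rewrite (bigD1 i) //= lerDl; apply: sumr_ge0 => *; apply: powR_ge0.
(* the term t - a makes the clock strictly increasing *)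
pose w t := (vsup phi a t + (t - a)) / W.
have phi_w s t : a <= s -> s <= t -> t <= b -> phi s t <= W * (w t - w s).
  move=> as_ st tb; rewrite /w -mulrBl mulrCA mulfV ?gt_eqF // mulr1.
  have := vsup_superadditive phi0 phiM (lexx a) as_ st tb.
  have := vsup_ge phiM as_ st tb; lra.
rewrite /sewing_constant mulrAC.
apply: (@dyadic_sewing _ _ _ a b delta _ sewing_ratio w) => //.
- exact: sqrtr_ge0.
- exact: sewing_ratio_lt1.
- move=> s t as_ st tb; rewrite ltr_pM2r ?invr_gt0 //.
  apply: ler_ltD; last by rewrite ltrD2r.
  apply: le_trans (vsup_superadditive phi0 phiM (lexx a) as_ (ltW st) tb).
  by rewrite lerDl; apply: (vsup_ge0 phi0 phiM) => //; apply: ltW.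
- move=> t /andP[at_ tb]; rewrite /w; apply/andP; split.
    rewrite divr_ge0 ?(ltW W0) // addr_ge0 // ?subr_ge0 //.
    exact: (vsup_ge0 phi0 phiM).
  rewrite ltr_pdivrMr // mul1r; apply: le_lt_trans MgW.
  by rewrite lerD ?lerD2r // (vsup_leM phiM).
move=> k n tau ctau alt tmesh.
have [tau1 tau2] := ctau.
have ci (c : 'I_n) : (c.*2.+2 <= n.*2)%N by rewrite -doubleS leq_double.
have tau_a i : (i <= n.*2)%N -> a <= tau i by move=> /tau2/andP[].
have tau_b i : (i <= n.*2)%N -> tau i <= b by move=> /tau2/andP[].
have i0 (c : 'I_n) : (c.*2 <= n.*2)%N by apply: leq_trans (ci c); apply: leqW.
have i1 (c : 'I_n) : (c.*2.+1 <= n.*2)%N by apply: leq_trans (ci c).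
pose lam := W * 2^-1 ^+ k.
have lam0 : 0 <= lam by rewrite mulr_ge0 ?exprn_ge0 ?invr_ge0 // (ltW W0).
have small (c : 'I_n) : tau c.*2.+1 = tau c.*2.+2 \/
    phi (tau c.*2) (tau c.*2.+1) <= lam.
  have [|h] := alt c (ltn_ord c); [by left | right].
  apply: le_trans (phi_w _ _ _ _ _) _; rewrite ?tau_a ?tau_b ?tau1 //.
  by rewrite ler_wpM2l // ltW.
pose C := lam `^ (excess / q) * e `^ excess * m.
have C0 : 0 <= C by rewrite !mulr_ge0 ?powR_ge0.
have main : `|\sum_(c < n) defect Xi (tau c.*2) (tau c.*2.+1) (tau c.*2.+2)| ^+ 2
    <= C * (W + 1).
  apply: le_trans (Dbound n tau ctau) _.
  apply: (@le_trans _ _ (\sum_(c < n) \sum_(c' < n) C *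
    (`|rect_incr G (tau c.*2) (tau c.*2.+1) (tau c'.*2) (tau c'.*2.+1)| `^ q +
     (`|rect_incr K (tau c.*2.+1) (tau c.*2.+2) (tau c'.*2.+1) (tau c'.*2.+2)|
        / m) `^ rho))).
    apply: ler_sum => c _; apply: ler_sum => c' _.
    apply: young_product => //; last first.
      by apply: Kmesh; rewrite ?tau_a ?tau_b ?tau1 // tmesh.
    case: (small c) => [->|hc]; first by left; rewrite rect_incr_diagl normr0.
    case: (small c') => [->|hc']; first by left; rewrite rect_incr_diagr normr0.
    right; have := cs (tau c.*2) (tau c.*2.+1) (tau c'.*2) (tau c'.*2.+1).
    rewrite !tau_a ?tau_b ?tau1 // => /(_ isT isT isT isT isT isT) csc.
    apply: le_trans (ge0_ler_powR (ltW q_gt0) _ _ csc) _;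
      rewrite ?nnegrE // ?le_max ?normr_ge0 //.
    by case: (leP `|rect_incr G (tau c.*2) _ _ _|) => _.
  under eq_bigr do rewrite -mulr_sumr big_split /=.
  rewrite -mulr_sumr big_split /= ler_wpM2l // lerD //.
    apply: le_trans (grid_sum_even _ _ _ _) _.
    apply: le_trans (Gvar _ _ _ _ ctau ctau) _; apply: ltW.
    by apply: le_lt_trans MgW; rewrite lerDl subr_ge0.
  move: m0; rewrite le_eqVlt => /predU1P[m0|m0].
    rewrite big1 // => c _; rewrite big1 // => c' _.
    by rewrite -m0 invr0 mulr0 powR0 // gt_eqF.
  have mr : 0 < m `^ rho by rewrite powR_gt0.
  under eq_bigr do under eq_bigr do rewrite powRM ?invr_ge0 ?(ltW m0) //.
  under eq_bigr do rewrite -mulr_suml.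
  have -> : m^-1 `^ rho = (m `^ rho)^-1.
    by rewrite -powR_inv1 ?(ltW m0) // -powRrM mulN1r powRN.
  rewrite -mulr_suml ler_pdivrMr // mul1r.
  exact: le_trans (grid_sum_odd _ _ _ _) (Kvar _ _ _ _ ctau ctau).
have -> : Num.sqrt (W `^ (excess / q) * (W + 1)) * Num.sqrt (e `^ excess * m) *
    sewing_ratio ^+ k = Num.sqrt (C * (W + 1)).
  have -> : sewing_ratio ^+ k = Num.sqrt ((2^-1 `^ (excess / q)) ^+ k).
    elim: k {alt lam lam0 small C C0 main} => [|k IH].
      by rewrite !expr0 sqrtr1.
    by rewrite !exprS IH /sewing_ratio sqrtrM ?powR_ge0.
  rewrite -!sqrtrM ?mulr_ge0 ?powR_ge0 ?addr_ge0 ?(ltW W0) //.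
  congr Num.sqrt; rewrite /C /lam powRM ?exprn_ge0 ?invr_ge0 ?(ltW W0) //.
  have -> : (2^-1 ^+ k : R) `^ (excess / q) = (2^-1 `^ (excess / q)) ^+ k.
    by rewrite -powR_mulrn ?invr_ge0 // powRAC powR_mulrn ?powR_ge0.
  by ring.
rewrite -(ler_sqr) ?nnegrE ?sqrtr_ge0 // sqr_sqrtr //.
by rewrite mulr_ge0 // addr_ge0 // (ltW W0).
Qed.

End HilbertSewing.

(** * Partitions and convergence of Riemann sums *)
Section Partitions.
Context {R : realType}.
Variable T : R.
Implicit Types r : seq R.

Lemma pnt_incr r : itv_partition 0 T r ->
  forall i, (i < size r)%N -> pnt 0 r i < pnt 0 r i.+1.
Proof. by case=> /(pathP 0) H _ i /H. Qed.

Lemma pnt_top r : itv_partition 0 T r -> pnt 0 r (size r) = T.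
Proof. by case=> _ /eqP e; rewrite pnt_last. Qed.

Lemma pnt_itv r i : itv_partition 0 T r -> (i <= size r)%N ->
  0 <= pnt 0 r i <= T.
Proof.
move=> pr ir; have H := steps_le (fun i h => ltW (pnt_incr pr h)).
by rewrite -{1}(pnt_top pr) H // andbT; apply: (H 0%N).
Qed.

Lemma mem_pnt r y : y \in 0 :: r -> exists2 i, (i <= size r)%N & y = pnt 0 r i.
Proof. by move=> /(nthP 0)[i ir <-]; exists i. Qed.

Lemma pnt_mem r i : (i <= size r)%N -> pnt 0 r i \in 0 :: r.
Proof. by move=> ir; apply: mem_nth. Qed.

Lemma itv_partition_mem_itv r y : itv_partition 0 T r -> y \in 0 :: r ->
  0 <= y <= T.
Proof. by move=> pr /mem_pnt[i ir ->]; apply: pnt_itv. Qed.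

Lemma mesh_lt r delta : 0 < delta ->
  (mesh 0 r < delta) <-> (forall i, (i < size r)%N -> pnt 0 r i.+1 - pnt 0 r i < delta).
Proof.
move=> d0; split=> [/bigmax_ltP[_ H] i ir|H]; first exact: (H (Ordinal ir)).
by apply/bigmax_ltP; split=> // i _; apply: H.
Qed.

Lemma mesh_refine r r' delta : itv_partition 0 T r -> itv_partition 0 T r' ->
  {subset 0 :: r <= 0 :: r'} -> 0 < delta -> mesh 0 r < delta ->
  mesh 0 r' < delta.
Proof.
move=> pr pr' sub d0 /(mesh_lt _ d0) H; apply/(mesh_lt _ d0) => i ir.
have r'_lt := steps_lt (pnt_incr pr').
have r'_le := steps_le (fun i h => ltW (pnt_incr pr' h)).
set x := pnt 0 r' i.
have [j jr /andP[jx xj]] : exists2 j, (j < size r)%N &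
    pnt 0 r j <= x < pnt 0 r j.+1.
  have x0 : pnt 0 r 0 <= x by have /andP[] := pnt_itv pr' (ltnW ir).
  have : x < pnt 0 r (size r).
    by rewrite (pnt_top pr) -(pnt_top pr') r'_lt.
  have : (size r <= size r)%N by [].
  elim: {1 3}(size r) => [|k IH] kr; first by rewrite ltNge x0.
  case: (leP (pnt 0 r k) x) => [h1 h2|h _]; first by exists k; rewrite ?h1.
  by apply: IH => //; apply: ltnW.
have [k kr' ek] := mem_pnt (sub _ (pnt_mem jr)).
apply: le_lt_trans (H j jr); apply: lerB => //.
rewrite ek; apply: (r'_le) => //; rewrite ltnNge; apply/negP => ki.
by have := r'_le _ _ ki (ltnW ir); rewrite -ek leNgt xj.
Qed.

Lemma itv_partition_refine r (L : seq R) : itv_partition 0 T r -> 0 < T ->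
  (forall y, y \in L -> 0 <= y <= T) ->
  exists r', [/\ itv_partition 0 T r', {subset 0 :: r <= 0 :: r'} &
    {subset L <= 0 :: r'}].
Proof.
move=> pr T0 LT.
pose s := [seq y <- undup (r ++ L) | 0 < y]; pose r' := sort <=%O s.
have mem_r' y : (y \in r') = (0 < y) && ((y \in r) || (y \in L)).
  by rewrite mem_sort mem_filter mem_undup mem_cat.
have r_itv y : y \in r -> 0 < y <= T.
  move=> yr; have /andP[_ ->] : 0 <= y <= T.
    by apply: itv_partition_mem_itv pr _; rewrite inE yr orbT.
  case: pr; rewrite path_sortedE; last exact: lt_trans.
  by move=> /andP[/allP h _] _; rewrite h.
have r'T y : y \in r' -> y <= T.
  by rewrite mem_r' => /andP[_ /orP[/r_itv/andP[]|/LT/andP[]]].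
have Tr' : T \in r'.
  rewrite mem_r' T0; have : T \in 0 :: r.
    by rewrite -(pnt_top pr) pnt_mem.
  by rewrite inE => /predU1P[e|->//]; move: T0; rewrite e ltxx.
have pr'p : path <%R 0 r'.
  rewrite path_sortedE; last exact: lt_trans.
  apply/andP; split; first by apply/allP => y; rewrite mem_r' => /andP[].
  by rewrite sort_lt_sorted filter_uniq // undup_uniq.
have pr' : itv_partition 0 T r'.
  split=> //; rewrite eq_le; apply/andP; split.
    have : last 0 r' \in r' by case: (r') Tr' => // y z _ /=; rewrite mem_last.
    exact: r'T.
  have [k kr ->] := @mem_pnt r' T (@mem_behead _ (0 :: r') _ Tr').
  rewrite -pnt_last; apply: (@steps_le _ (size r')) => // i h; apply: ltW.
  by move/(pathP 0): pr'p => /(_ i h).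
exists r'; split=> // y.
  rewrite inE => /predU1P[->|yr]; first by rewrite inE eqxx.
  by rewrite inE mem_r' yr; have /andP[-> _] := r_itv y yr; rewrite orbT.
move=> yL; have /andP[] := LT y yL; rewrite le_eqVlt => /predU1P[<- _|y0 _].
  by rewrite inE eqxx.
by rewrite inE mem_r' y0 yL !orbT.
Qed.

Lemma uniform_partition N : 0 < T -> exists2 r, itv_partition 0 T r &
  size r = N.+1 /\ forall i, (i < N.+1)%N ->
    pnt 0 r i.+1 - pnt 0 r i = T / N.+1%:R.
Proof.
move=> T0; pose r := mkseq (fun k => T * (k.+1)%:R / N.+1%:R) N.+1.
have sz : size r = N.+1 by rewrite size_mkseq.
have rE i : (i <= N.+1)%N -> pnt 0 r i = T * i%:R / N.+1%:R.
  case: i => [|i] iN; first by rewrite mulr0 mul0r.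
  by rewrite /pnt [LHS]/= nth_mkseq.
have stp i : (i < N.+1)%N -> pnt 0 r i.+1 - pnt 0 r i = T / N.+1%:R.
  move=> iN; rewrite (rE i.+1 iN) (rE i (ltnW iN)) -mulrBl -mulrBr.
  by rewrite -natrB // subSnn mulr1.
exists r => //; split; last by rewrite -pnt_last sz rE // mulfK // pnatr_eq0.
apply/(pathP 0) => i; rewrite sz => iN.
by rewrite -subr_gt0 (stp i iN) divr_gt0 // ltr0n.
Qed.

Lemma small_mesh_partition delta : 0 < T -> 0 < delta ->
  exists2 r, itv_partition 0 T r & mesh 0 r < delta.
Proof.
move=> T0 d0; have Td : 0 <= T / delta by rewrite divr_ge0 ?ltW.
have [r pr [sz stp]] := uniform_partition (Num.bound (T / delta)) T0.
exists r => //; apply/(mesh_lt _ d0) => i; rewrite sz => iN.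
rewrite stp // ltr_pdivrMr ?ltr0n // mulrC -ltr_pdivrMr //.
apply: lt_trans (archi_boundP Td) _; rewrite ltr_nat //.
Qed.

#[global] Instance mesh_to0_filter : Filter (mesh_to0 T).
Proof.
apply: filter_from_filter; first by exists 1; rewrite /= ltr01.
move=> i j /= i0 j0; exists (Num.min i j); first by rewrite /= lt_min i0 j0.
by move=> r [pr]; rewrite lt_min => /andP[mi mj]; split.
Qed.

Lemma mesh_to0_proper : 0 < T -> ProperFilter (mesh_to0 T).
Proof.
move=> T0; apply: (@filter_from_proper _ _ _ _ mesh_to0_filter).
by move=> d d0; have [r pr mr] := small_mesh_partition T0 d0; exists r.
Qed.

(** Two partitions of small mesh are compared through a common refinement. *)
Lemma path_sum_cvg (V : completeNormedModType R) (Xi : R -> R -> V) :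
  0 < T ->
  (forall eps, 0 < eps -> exists2 delta, 0 < delta &
     forall r r', itv_partition 0 T r -> itv_partition 0 T r' ->
       mesh 0 r < delta -> {subset 0 :: r <= 0 :: r'} ->
       `|path_sum Xi 0 r' - path_sum Xi 0 r| <= eps) ->
  cvg (path_sum Xi 0 @ mesh_to0 T).
Proof.
move=> T0 H; have FF := mesh_to0_proper T0.
apply/cauchy_cvgP; apply: cauchy_exP => eps eps0.
have [d d0 Hd] := H (eps / 3) ltac:(by rewrite divr_gt0).
have [r0 pr0 mr0] := small_mesh_partition T0 d0.
exists (path_sum Xi 0 r0); exists d => // r [pr mr] /=.
have [r' [pr' sub1 sub2]] := itv_partition_refine pr T0
  (fun y (h : y \in r0) => itv_partition_mem_itv pr0 (@mem_behead _ (0 :: r0) _ h)).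
have h1 := Hd r r' pr pr' mr sub1.
have h2 := Hd r0 r' pr0 pr' mr0.
rewrite -ball_normE /ball_ /=.
have -> : path_sum Xi 0 r0 - path_sum Xi 0 r =
    (path_sum Xi 0 r' - path_sum Xi 0 r) - (path_sum Xi 0 r' - path_sum Xi 0 r0).
  by rewrite opprB [RHS]addrC addrA subrK.
apply: le_lt_trans (ler_normB _ _) _.
have : {subset 0 :: r0 <= 0 :: r'}.
  by move=> y; rewrite inE => /predU1P[->|/sub2 //]; rewrite inE eqxx.
move=> /h2; move: h1; lra.
Qed.

End Partitions.

(** * Scalar and Hilbert-valued Young sums *)
Section Kernels.
Context {R : realType}.

(** Takes the place of the continuity of a control for the grid variation. *)
Definition small_rectangles (T : R) (K : R -> R -> R) : Prop :=
  forall eps, 0 < eps -> exists2 delta, 0 < delta &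
    forall u t u' t', 0 <= u -> u <= t -> t <= T ->
      0 <= u' -> u' <= t' -> t' <= T -> t - u < delta -> t' - u' < delta ->
      `|rect_incr K u t u' t'| <= eps.

Variables (q rho : R).
Hypotheses (q_gt0 : 0 < q) (rho_gt0 : 0 < rho) (q_rho : 1 < q^-1 + rho^-1).

Lemma hilbert_path_sum_cvg (T : R) (V : completeNormedModType R)
    (Xi : R -> R -> V) (G K : R -> R -> R) (Mg M : R) :
  0 < T -> (forall s, Xi s s = 0) -> cauchy_schwarz 0 T G ->
  grid_var q 0 T G Mg -> grid_var rho 0 T K M -> small_rectangles T K ->
  defect_bound 0 T Xi G K ->
  cvg (path_sum Xi 0 @ mesh_to0 T).
Proof.
move=> T0 Xi0 cs Gvar Kvar Ksmall Dbound.
have M0 : 0 <= M := grid_var_ge0 (ltW T0) Kvar.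
apply: path_sum_cvg => // eps eps0.
(* M + 1 rather than M: the size m must not vanish *)
pose m := (M + 1) `^ rho^-1; have m0 : 0 < m by rewrite powR_gt0 ?ltr_wpDl.
have Kvar' : grid_var rho 0 T K (m `^ rho).
  move=> n u n' v cu cv; apply: le_trans (Kvar _ _ _ _ cu cv) _.
  by rewrite /m -powRrM mulVf ?gt_eqF // powRr1 ?lerDl ?addr_ge0.
pose W := Mg + T + 1.
set C := sewing_constant q rho W.
have C0 : 0 <= C.
  rewrite divr_ge0 ?sqrtr_ge0 // subr_ge0 ltW //.
  exact: (sewing_ratio_lt1 q_gt0 q_rho).
have al0 := excess_gt0 q_rho.
pose y := (eps / (C + 1)) ^+ 2 / m.
have C1 : 0 < C + 1 by rewrite ltr_wpDl.
have y0 : 0 < y by rewrite divr_gt0 // exprn_gt0 // divr_gt0.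
pose e := y `^ (excess q rho)^-1.
have e0 : 0 < e by rewrite powR_gt0.
have [delta delta0 Hd] := Ksmall (e * m) (mulr_gt0 e0 m0).
exists delta => // r r' pr pr' /(mesh_lt _ delta0) mr sub.
have := @hilbert_sewing _ q rho q_gt0 rho_gt0 q_rho V Xi G K 0 T Mg m e delta W
  (ltW T0) (ltW m0) (ltW e0) Xi0 cs Gvar Kvar' Hd Dbound.
have MW : Mg + (T - 0) < W by rewrite subr0 ltrDl.
move=> /(_ MW (size r) (pnt 0 r) (size r') (pnt 0 r') erefl (pnt_top pr)).
move=> /(_ (pnt_incr pr) erefl (pnt_top pr') (pnt_incr pr') _ mr) H.
apply: le_trans (H _) _ => [i ir|].
  by have [j jr ->] := mem_pnt (sub _ (pnt_mem ir)); exists j.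
rewrite -/C /e -powRrM mulVf ?gt_eqF // powRr1 ?(ltW y0) //.
rewrite /y divfK ?gt_eqF // sqrtr_sqr ger0_norm; last by rewrite divr_ge0 // ltW.
by rewrite mulrA ler_pdivrMr // mulrC ler_wpM2l ?(ltW eps0) // lerDl.
Qed.

Definition path_var (a b : R) (f : R -> R) M : Prop := forall n u,
  chain a b n u -> \sum_(i < n) `|f (u i.+1) - f (u i)| `^ q <= M.

Lemma rect_incr_prod (f g : R -> R) a b c d :
  rect_incr (fun s t => f s * g t) a b c d = (f b - f a) * (g d - g c).
Proof. by rewrite /rect_incr; ring. Qed.

End Kernels.

Lemma ler_normM_max (R : realType) (x y : R) :
  `|x * y| <= Num.max `|x * x| `|y * y|.
Proof.
rewrite !normrM le_max; case: (leP `|x| `|y|) => h.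
  by rewrite (ler_wpM2r _ h) // orbT.
by rewrite (ler_wpM2l _ (ltW h)).
Qed.

Section ScalarYoung.
Context {R : realType}.
Variables (q rho : R).
Hypotheses (q_gt0 : 0 < q) (rho_gt0 : 0 < rho) (q_rho : 1 < q^-1 + rho^-1).

Lemma grid_var_prod p a b (f g : R -> R) (M N : R) :
  path_var p a b f M -> path_var p a b g N -> a <= b ->
  grid_var p a b (fun s t => f s * g t) (M * N).
Proof.
move=> Mf Ng ab n u m v cu cv; rewrite /grid_sum.
under eq_bigr do under eq_bigr do rewrite rect_incr_prod normrM powRM //.
under eq_bigr do rewrite -mulr_sumr.
rewrite -mulr_suml; apply: ler_pM; rewrite ?Mf ?Ng //;
  by apply: sumr_ge0 => *; apply: powR_ge0.
Qed.

(** The case of rank one kernels: [K s t = xi s * xi t] has grid variation at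
    most [A ^ 2]. Homogeneity in [A] is what makes the bound useful on small
    intervals. *)
Lemma scalar_young (f xi : R -> R) (s t Mf A W : R) : s < t ->
  path_var q s t f Mf -> path_var rho s t xi A -> 0 <= A ->
  Mf * Mf + (t - s) < W ->
  forall n r, r 0%N = s -> r n = t -> (forall i, (i < n)%N -> r i < r i.+1) ->
  `|\sum_(i < n) f (r i) * (xi (r i.+1) - xi (r i)) - f s * (xi t - xi s)| <=
    sewing_constant q rho W * A `^ rho^-1.
Proof.
move=> st fM xiA A0 W_gt n r r0 rn r_incr.
pose Xi x y : R := f x * (xi y - xi x).
pose G x y := f x * f y; pose K x y := xi x * xi y.
(* m ^ rho = A ^ 2, the grid variation of the product kernel *)
pose m := A `^ rho^-1 * A `^ rho^-1.
have m0 : 0 <= m by rewrite mulr_ge0 ?powR_ge0.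
have mrho : m `^ rho = A * A.
  by rewrite powRM ?powR_ge0 // -powRrM mulVf ?gt_eqF // powRr1.
have Kvar : grid_var rho s t K (m `^ rho).
  by rewrite mrho; apply: grid_var_prod => //; apply: ltW.
have := @hilbert_sewing _ q rho q_gt0 rho_gt0 q_rho R Xi G K s t (Mf * Mf) m 1
  (t - s + 1) W (ltW st) m0 ler01.
rewrite powR1 mul1r sqrtr_sqr ger0_norm ?powR_ge0 //.
have -> : \sum_(i < n) f (r i) * (xi (r i.+1) - xi (r i)) =
  \sum_(i < n) Xi (r i) (r i.+1) by [].
pose p i := if i is 0%N then s else t.
have -> : f s * (xi t - xi s) = \sum_(i < 1) Xi (p i) (p i.+1).
  by rewrite big_ord1.
apply=> //.
- by move=> x; rewrite /Xi subrr mulr0.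
- move=> x y x' y' _ _ _ _ _ _; rewrite !rect_incr_prod.
  exact: ler_normM_max.
- by apply: grid_var_prod => //; apply: ltW.
- move=> u v u' v' su uv vt su' u'v' v't _ _.
  have := Kvar 1%N _ 1%N _ (chain_pair su uv vt) (chain_pair su' u'v' v't).
  rewrite /grid_sum !big_ord1 => h.
  rewrite leNgt; apply/negP => h2; move: h; rewrite leNgt.
  by rewrite gt0_ltr_powR // ?nnegrE.
- move=> k tau ctau.
  have -> : \sum_(c < k) defect Xi (tau c.*2) (tau c.*2.+1) (tau c.*2.+2) =
     - \sum_(c < k) (f (tau c.*2.+1) - f (tau c.*2)) *
                    (xi (tau c.*2.+2) - xi (tau c.*2.+1)).
    by rewrite -sumrN; apply: eq_bigr => c _; rewrite /defect /Xi; ring.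
  rewrite normrN -normrX expr2 mulr_suml.
  apply: le_trans (ler_norm_sum _ _ _) _; apply: ler_sum => c _.
  rewrite mulr_sumr; apply: le_trans (ler_norm_sum _ _ _) _.
  apply: ler_sum => c' _; rewrite !rect_incr_prod -normrM.
  by rewrite mulrACA.
- by case.
- case=> [|[|i]] // _; first by exists 0%N.
  by exists n.
- by case=> // _ /=; rewrite ltrDl.
Qed.

End ScalarYoung.

(** * Stability of finite variation *)
Section BoundedVariation.
Context {R : realType}.
Variable T : R.
Hypothesis T_gt0 : 0 < T.
Implicit Types (q : R) (f g : R -> R) (G : R -> R -> R).

Definition bv q f : Prop := exists M, path_var q 0 T f M.
Definition grid_bv q G : Prop := exists M, grid_var q 0 T G M.

Lemma powR_normD q (x y : R) : 0 < q ->
  `|x + y| `^ q <= 2 `^ q * (`|x| `^ q + `|y| `^ q).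
Proof.
move=> q0; wlog xy : x y / `|x| <= `|y|.
  move=> H; case: (leP `|x| `|y|) => [/H //|/ltW/H].
  by rewrite addrC [X in _ * X]addrC.
apply: (@le_trans _ _ ((2 * `|y|) `^ q)).
  apply: ge0_ler_powR; rewrite ?nnegrE ?mulr_ge0 ?(ltW q0) //.
  by rewrite (le_trans (ler_normD _ _)) // mulr_natl mulr2n lerD2r.
by rewrite powRM // ler_wpM2l ?powR_ge0 // lerDr powR_ge0.
Qed.

Lemma powR_norm_le q (x B : R) : 0 < q -> `|x| <= B -> `|x| `^ q <= B `^ q.
Proof.
move=> q0 xB; apply: ge0_ler_powR; rewrite ?nnegrE ?(ltW q0) //.
exact: le_trans xB.
Qed.

(** Each term is bounded by the total, so raising the exponent costs a
    constant factor. *)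
Lemma sum_powR_exponent (I : finType) (F : I -> R) p q M : 0 < p -> p <= q ->
  (forall i, 0 <= F i) -> \sum_i F i `^ p <= M ->
  \sum_i F i `^ q <= M * M `^ ((q - p) / p).
Proof.
move=> p0 pq F0 FM; have q0 := lt_le_trans p0 pq.
have M0 : 0 <= M by apply: le_trans FM; apply: sumr_ge0 => *; apply: powR_ge0.
have FiM i : F i `^ p <= M.
  apply: le_trans FM; rewrite (bigD1 i) //= lerDl.
  by apply: sumr_ge0 => *; apply: powR_ge0.
apply: (@le_trans _ _ (\sum_i F i `^ p * M `^ ((q - p) / p))); last first.
  by rewrite -mulr_suml ler_wpM2r // powR_ge0.
apply: ler_sum => i _; have := F0 i; rewrite le_eqVlt => /predU1P[<-|Fi].
  by rewrite powR0 ?gt_eqF // mulr_ge0 // powR_ge0.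
have {1}-> : q = p + p * ((q - p) / p) by field; rewrite gt_eqF.
rewrite powRD; last by rewrite (gt_eqF Fi) implybT.
rewrite ler_wpM2l ?powR_ge0 // (powRrM (F i) p).
by apply: ge0_ler_powR; rewrite ?nnegrE ?powR_ge0 // divr_ge0 ?subr_ge0 // ltW.
Qed.

Lemma path_var_exponent p q a b f M : 0 < p -> p <= q ->
  path_var p a b f M -> path_var q a b f (M * M `^ ((q - p) / p)).
Proof.
move=> p0 pq fM n u cu.
exact: (sum_powR_exponent (F := fun i : 'I_n => `|f (u i.+1) - f (u i)|)
  p0 pq (fun=> normr_ge0 _) (fM n u cu)).
Qed.

Lemma grid_bv_exponent p q G : 0 < p -> p <= q -> grid_bv p G -> grid_bv q G.
Proof.
move=> p0 pq [M HM]; exists (M * M `^ ((q - p) / p)) => n u m v cu cv.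
have := HM n u m v cu cv; rewrite /grid_sum !pair_bigA /=.
exact: (sum_powR_exponent (F := fun ij : 'I_n * 'I_m =>
  `|rect_incr G (u ij.1) (u ij.1.+1) (v ij.2) (v ij.2.+1)|)
  p0 pq (fun=> normr_ge0 _)).
Qed.

Lemma bv_bounded q f : 0 < q -> bv q f ->
  exists2 B, 0 <= B & forall t, 0 <= t <= T -> `|f t| <= B.
Proof.
move=> q0 [M HM]; have M0 : 0 <= M.
  by have := HM 0%N _ (chain_cst 0 (ltW T_gt0)); rewrite big_ord0.
exists (M `^ q^-1 + `|f 0|); first by rewrite addr_ge0 ?powR_ge0.
move=> t /andP[t0 tT].
have := HM 1%N _ (chain_pair (lexx 0) t0 tT); rewrite big_ord1 /= => h.
have h2 : `|f t - f 0| <= M `^ q^-1.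
  rewrite -[leLHS](powRr1 (normr_ge0 _)) -(@mulfV _ q) ?gt_eqF // powRrM.
  by apply: ge0_ler_powR; rewrite ?nnegrE ?powR_ge0 // invr_ge0 ltW.
by rewrite -[f t](subrK (f 0)) (le_trans (ler_normD _ _)) // lerD2r.
Qed.

Lemma bvM q f g : 0 < q -> bv q f -> bv q g -> bv q (fun t => f t * g t).
Proof.
move=> q0 fbv gbv; have [B B0 fB] := bv_bounded q0 fbv.
have [C C0 gC] := bv_bounded q0 gbv.
have [M HM] := fbv; have [N HN] := gbv.
exists (2 `^ q * (C `^ q * M + B `^ q * N)) => n u cu; have [_ u2] := cu.
apply: (@le_trans _ _ (\sum_(i < n) 2 `^ q *
   (C `^ q * `|f (u i.+1) - f (u i)| `^ q +
    B `^ q * `|g (u i.+1) - g (u i)| `^ q))).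
  apply: ler_sum => i _.
  have -> : f (u i.+1) * g (u i.+1) - f (u i) * g (u i) =
     (f (u i.+1) - f (u i)) * g (u i.+1) + f (u i) * (g (u i.+1) - g (u i)).
    by ring.
  apply: le_trans (powR_normD _ _ q0) _; rewrite ler_wpM2l ?powR_ge0 //.
  rewrite !normrM !powRM // [_ * `|g (u i.+1)| `^ q]mulrC.
  apply: lerD; rewrite ler_wpM2r ?powR_ge0 //; apply: powR_norm_le => //.
    by apply: gC; apply: u2.
  by apply: fB; apply: u2; apply: ltnW.
rewrite -mulr_sumr big_split /= -!mulr_sumr ler_wpM2l ?powR_ge0 //.
by rewrite lerD // ler_wpM2l ?powR_ge0 ?HM ?HN.
Qed.

(** On [[0, T]] the indicator jumps at most once, from 1 down to 0, so the
    sum is dominated by a telescoping one. *)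
Lemma bv_indic q t : 0 < q -> bv q (\1_(`[0, t[ : set R)).
Proof.
move=> q0; exists 1 => n u [u1 u2].
pose h s : R := \1_(`[0, t[ : set R) s.
have hE s : 0 <= s -> h s = (s < t)%R%:R.
  move=> s0; rewrite /h indicE; congr (_%:R); congr nat_of_bool.
  by rewrite mem_setE in_itv /= s0.
apply: (@le_trans _ _ (\sum_(i < n) (h (u i) - h (u i.+1)))).
  apply: ler_sum => i _.
  change (`|h (u i.+1) - h (u i)| `^ q <= h (u i) - h (u i.+1)).
  have /andP[a0 _] := u2 i (ltnW (ltn_ord i)).
  have /andP[b0 _] := u2 i.+1 (ltn_ord i).
  have u12 := u1 i (ltn_ord i).
  rewrite !hE //; case: (ltP (u i.+1) t) => h1.
    by rewrite (le_lt_trans u12 h1) subrr normr0 powR0 ?gt_eqF.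
  case: (u i < t); first by rewrite sub0r normrN normr1 powR1 subr0.
  by rewrite subrr normr0 powR0 ?gt_eqF.
have -> : \sum_(i < n) (h (u i) - h (u i.+1)) = h (u 0%N) - h (u n).
  elim: n {u1 u2} => [|n IH]; first by rewrite big_ord0 subrr.
  by rewrite big_ord_recr /= IH addrA subrK.
have /andP[a0 _] := u2 0%N (leq0n _); have /andP[b0 _] := u2 n (leqnn _).
by rewrite !hE //; case: (_ < t); case: (_ < t); rewrite ?subrr ?subr0 ?sub0r ?oppr_le0 // ?ler01 // lerN10.
Qed.

Lemma grid_bv_cst0 q : 0 < q -> grid_bv q (fun _ _ => 0).
Proof.
move=> q0; exists 0 => n u m v _ _; rewrite /grid_sum big1 // => i _.
rewrite big1 // => j _; rewrite /rect_incr !(subr0, addr0) normr0 powR0 //.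
by rewrite gt_eqF.
Qed.

Lemma grid_bvD q G1 G2 : 0 < q -> grid_bv q G1 -> grid_bv q G2 ->
  grid_bv q (fun s t => G1 s t + G2 s t).
Proof.
move=> q0 [M HM] [N HN]; exists (2 `^ q * (M + N)) => n u m v cu cv.
apply: (@le_trans _ _ (\sum_(i < n) \sum_(j < m) 2 `^ q *
  (`|rect_incr G1 (u i) (u i.+1) (v j) (v j.+1)| `^ q +
   `|rect_incr G2 (u i) (u i.+1) (v j) (v j.+1)| `^ q))).
  apply: ler_sum => i _; apply: ler_sum => j _.
  rewrite [X in `|X|](_ : _ = rect_incr G1 (u i) (u i.+1) (v j) (v j.+1) +
    rect_incr G2 (u i) (u i.+1) (v j) (v j.+1)); first exact: powR_normD.
  by rewrite /rect_incr; ring.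
under eq_bigr do rewrite -mulr_sumr big_split /=.
rewrite -mulr_sumr big_split /= ler_wpM2l ?powR_ge0 // lerD //.
  exact: HM.
exact: HN.
Qed.

Lemma grid_bv_sum q (I : Type) (s : seq I) (F : I -> R -> R -> R) : 0 < q ->
  (forall i, grid_bv q (F i)) -> grid_bv q (fun x y => \sum_(i <- s) F i x y).
Proof.
move=> q0 Fbv; elim: s => [|i s IH].
  by under eq_fun do under eq_fun do rewrite big_nil; apply: grid_bv_cst0.
by under eq_fun do under eq_fun do rewrite big_cons; apply: grid_bvD.
Qed.

Lemma rect_incr_flip G a b c d :
  rect_incr (fun s t => G t s) a b c d = rect_incr G c d a b.
Proof. by rewrite /rect_incr; ring. Qed.

Lemma grid_bv_flip q G : grid_bv q G -> grid_bv q (fun s t => G t s).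
Proof.
move=> [M HM]; exists M => n u m v cu cv; rewrite /grid_sum exchange_big /=.
under eq_bigr do under eq_bigr do rewrite rect_incr_flip.
exact: HM.
Qed.

(** The increment of the product has an extra term [(f b - f a) (G b d - G b c)];
    as [G] vanishes at 0, its second factor is a rectangular increment over
    [[0, b]], so that it is controlled by the grid variation too. *)
Lemma grid_bvMl q f G : 0 < q -> bv q f -> grid_bv q G ->
  (forall t, G 0 t = 0) -> grid_bv q (fun s t => f s * G s t).
Proof.
move=> q0 fbv [M HM] G0; have [B B0 fB] := bv_bounded q0 fbv.
have [N HN] := fbv.
exists (2 `^ q * (B `^ q * M + N * M)) => n u m v cu cv; have [_ u2] := cu.
have [u1 _] := cu.
pose D i := `|f (u i.+1) - f (u i)| `^ q.
apply: (@le_trans _ _ (\sum_(i < n) \sum_(j < m) 2 `^ q *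
  (B `^ q * `|rect_incr G (u i) (u i.+1) (v j) (v j.+1)| `^ q +
   D i * `|rect_incr G 0 (u i.+1) (v j) (v j.+1)| `^ q))).
  apply: ler_sum => i _; apply: ler_sum => j _.
  rewrite [X in `|X|](_ : _ = f (u i) * rect_incr G (u i) (u i.+1) (v j) (v j.+1) +
    (f (u i.+1) - f (u i)) * rect_incr G 0 (u i.+1) (v j) (v j.+1)); last first.
    by rewrite /rect_incr !G0; ring.
  apply: le_trans (powR_normD _ _ q0) _; rewrite ler_wpM2l ?powR_ge0 //.
  rewrite !normrM !powRM // lerD // ler_wpM2r ?powR_ge0 //.
  by apply: powR_norm_le => //; apply: fB; apply: u2; apply: ltnW.
under eq_bigr do rewrite -mulr_sumr big_split /= -!mulr_sumr.
rewrite -mulr_sumr big_split /= -mulr_sumr ler_wpM2l ?powR_ge0 // lerD //.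
  by rewrite ler_wpM2l ?powR_ge0 //; apply: HM.
apply: (@le_trans _ _ (\sum_(i < n) D i * M)); last first.
  rewrite -mulr_suml ler_wpM2r //; last exact: HN.
  exact: grid_var_ge0 (ltW T_gt0) HM.
apply: ler_sum => i _; rewrite ler_wpM2l ?powR_ge0 //.
have /andP[b0 bT] := u2 i.+1 (ltn_ord i).
by have := HM _ _ _ _ (chain_pair (lexx 0) b0 bT) cv; rewrite /grid_sum big_ord1.
Qed.

Lemma grid_bvMr q f G : 0 < q -> bv q f -> grid_bv q G ->
  (forall s, G s 0 = 0) -> grid_bv q (fun s t => f t * G s t).
Proof.
move=> q0 fbv Gbv G0.
exact/(@grid_bv_flip _ (fun s t => f s * G t s))/grid_bvMl/G0/grid_bv_flip.
Qed.

End BoundedVariation.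

(** * Young integrals of Hilbert-valued paths *)
Section InnerProduct.
Context {R : realType} {V : normedModType R}.
Variable dot : V -> V -> R.
Hypothesis ip : is_inner_product dot.

Lemma dotC x y : dot x y = dot y x. Proof. exact: dot_sym ip x y. Qed.

Lemma dotDl x y z : dot (x + y) z = dot x z + dot y z.
Proof. by have := dot_linear ip 1 x y z; rewrite scale1r mul1r. Qed.

Lemma dot0l z : dot 0 z = 0.
Proof. by apply: (addrI (dot 0 z)); rewrite -dotDl !addr0. Qed.

Lemma dotZl a x z : dot (a *: x) z = a * dot x z.
Proof. by have := dot_linear ip a x 0 z; rewrite dot0l !addr0. Qed.

Lemma dotNl x z : dot (- x) z = - dot x z.
Proof. by rewrite -scaleN1r dotZl mulN1r. Qed.

Lemma dotBl x y z : dot (x - y) z = dot x z - dot y z.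
Proof. by rewrite dotDl dotNl. Qed.

Lemma dotDr x y z : dot z (x + y) = dot z x + dot z y.
Proof. by rewrite dotC dotDl !(dotC z). Qed.

Lemma dotNr x z : dot z (- x) = - dot z x.
Proof. by rewrite dotC dotNl dotC. Qed.

Lemma dot0r z : dot z 0 = 0. Proof. by rewrite dotC dot0l. Qed.

Lemma dotZr a x z : dot z (a *: x) = a * dot z x.
Proof. by rewrite dotC dotZl dotC. Qed.

Lemma dotBr x y z : dot z (x - y) = dot z x - dot z y.
Proof. by rewrite dotC dotBl !(dotC z). Qed.

Lemma dot_suml (I : Type) (s : seq I) (P : pred I) (F : I -> V) z :
  dot (\sum_(i <- s | P i) F i) z = \sum_(i <- s | P i) dot (F i) z.
Proof. by apply: (big_morph (dot^~ z)) => [x y|]; rewrite ?dotDl ?dot0l. Qed.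

Lemma dot_sumr (I : Type) (s : seq I) (P : pred I) (F : I -> V) z :
  dot z (\sum_(i <- s | P i) F i) = \sum_(i <- s | P i) dot z (F i).
Proof. by rewrite dotC dot_suml; under eq_bigr do rewrite dotC. Qed.

Lemma sqr_norm_sum n (F : nat -> V) : `|\sum_(i < n) F i| ^+ 2 =
  \sum_(i < n) \sum_(j < n) dot (F i) (F j).
Proof. by rewrite -(dot_norm ip) dot_suml; under eq_bigr do rewrite dot_sumr. Qed.

Lemma polarization x y :
  dot x y = 2^-1 * (`|x + y| * `|x + y| - `|x| * `|x| - `|y| * `|y|).
Proof.
rewrite -!expr2 -!(dot_norm ip) !dotDl !dotDr (dotC y x).
by field.
Qed.

Lemma dot_cvg (I : Type) (F : set_system I) {FF : Filter F} (f g : I -> V) x y :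
  f @ F --> x -> g @ F --> y -> dot (f i) (g i) @[i --> F] --> dot x y.
Proof.
move=> fx gy; rewrite polarization.
rewrite [X in X @ _](_ : _ = fun i => 2^-1 * (`|f i + g i| * `|f i + g i| -
  `|f i| * `|f i| - `|g i| * `|g i|)); last by apply/funext => i; rewrite polarization.
apply: cvgMr; apply: cvgB; first apply: cvgB; apply: cvgM;
  by apply: cvg_norm => //; apply: cvgD.
Qed.

(** From [|x + y|^2 >= 0] and [|x - y|^2 >= 0]; this weak form of the
    Cauchy-Schwarz inequality is all that [cauchy_schwarz] asks for. *)
Lemma norm_dot_le_max x y : `|dot x y| <= Num.max (dot x x) (dot y y).
Proof.
have p := dot_norm ip (x + y); have m := dot_norm ip (x - y).
have pp := sqr_ge0 `|x + y|; have mm := sqr_ge0 `|x - y|.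
rewrite -p in pp; rewrite -m in mm.
move: pp mm; rewrite !dotDl !dotDr !dotNl !dotNr (dotC y x) => pp mm.
rewrite le_max ler_norml; case: (leP (dot x x) (dot y y)) => h.
  by apply/orP; right; rewrite ler_norml; apply/andP; split; lra.
by apply/orP; left; apply/andP; split; lra.
Qed.

Lemma rect_incr_dot (x y : R -> V) a b c d :
  rect_incr (fun s t => dot (x s) (y t)) a b c d = dot (x b - x a) (y d - y c).
Proof. by rewrite /rect_incr !(dotBl, dotBr); ring. Qed.

Lemma cauchy_schwarz_dot a b (x : R -> V) :
  cauchy_schwarz a b (fun s t => dot (x s) (x t)).
Proof.
move=> s u s' u' _ _ _ _ _ _; rewrite !rect_incr_dot.
by apply: le_trans (norm_dot_le_max _ _) _; rewrite ge_max !le_max !ler_norm orbT.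
Qed.

End InnerProduct.

Section Integral.
Context {R : realType} {H : completeNormedModType R}.
Variables (dot : H -> H -> R) (T q rho : R).
Hypotheses (ip : is_inner_product dot) (T_gt0 : 0 < T).
Hypotheses (q_gt0 : 0 < q) (rho_gt0 : 0 < rho) (q_rho : 1 < q^-1 + rho^-1).
Implicit Types (phi : R -> R) (x : R -> H).

Definition germ phi x (s t : R) : H := phi s *: (x t - x s).

Definition cutoff phi (t s : R) : R := \1_(`[0, t[ : set R) s * phi s.

(** [int_0^t phi dx], as an integral over the whole of [[0, T]]. *)
Definition young_integral phi x (t : R) : H :=
  lim (path_sum (germ (cutoff phi t) x) 0 @ mesh_to0 T).

Lemma defect_germ phi x s u t :
  defect (germ phi x) s u t = - ((phi u - phi s) *: (x t - x u)).
Proof.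
rewrite /defect /germ -scalerBr.
have -> : x t - x s - (x u - x s) = x t - x u by rewrite opprB addrA subrK.
by rewrite -scalerBl -opprB scaleNr.
Qed.

Lemma germ_cvg phi x : bv T q phi ->
  grid_bv T rho (fun s t => dot (x s) (x t)) ->
  small_rectangles T (fun s t => dot (x s) (x t)) ->
  cvg (path_sum (germ phi x) 0 @ mesh_to0 T).
Proof.
move=> [M HM] [N HN] Ksmall.
apply: (hilbert_path_sum_cvg q_gt0 rho_gt0 q_rho T_gt0 (G := fun s t => phi s * phi t)
  _ _ _ HN Ksmall).
- by move=> s; rewrite /germ subrr scaler0.
- by move=> s u s' u' _ _ _ _ _ _; rewrite !rect_incr_prod; apply: ler_normM_max.
- exact: (grid_var_prod HM HM (ltW T_gt0)).
- move=> n tau _.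
  pose F c := - ((phi (tau c.*2.+1) - phi (tau c.*2)) *:
     (x (tau c.*2.+2) - x (tau c.*2.+1))).
  under eq_bigr do rewrite defect_germ -/(F _).
  rewrite (sqr_norm_sum ip); apply: ler_sum => c _; apply: ler_sum => c' _.
  rewrite /F -!scaleNr (dotZl ip) (dotZr ip) rect_incr_prod (rect_incr_dot ip).
  by rewrite mulrA -normrM mulrNN ler_norm.
Qed.

Lemma bv_cutoff phi t : bv T q phi -> bv T q (cutoff phi t).
Proof. by move=> hphi; apply: bvM => //; apply: bv_indic. Qed.

(** A limit along all fine partitions can be estimated along those containing
    two given points. *)
Lemma mesh_lim_le (f : seq R -> R) (l B : R) : f @ mesh_to0 T --> l ->
  (forall delta, 0 < delta -> exists r,
     [/\ itv_partition 0 T r, mesh 0 r < delta & `|f r| <= B]) -> `|l| <= B.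
Proof.
move=> fl H1; have FF := mesh_to0_proper T_gt0; rewrite leNgt; apply/negP => lB.
have := cvgr_gt _ (cvg_norm fl) _ lB.
move=> [d d0 Hd]; have [r [pr mr]] := H1 d d0.
by rewrite leNgt (Hd r).
Qed.

Lemma cutoffE phi t s : 0 <= s -> cutoff phi t s = (s < t)%R%:R * phi s.
Proof.
move=> s0; rewrite /cutoff indicE; congr (_%:R * _); congr nat_of_bool.
by rewrite mem_setE in_itv /= s0.
Qed.

(** For end points in the partition, the integral over [[s, t]] is again
    approximated by Riemann sums, without boundary terms. *)
Lemma cutoff_path_sum phi x r i j : itv_partition 0 T r ->
  (i <= j)%N -> (j <= size r)%N ->
  path_sum (germ (cutoff phi (pnt 0 r j)) x) 0 r -
  path_sum (germ (cutoff phi (pnt 0 r i)) x) 0 r =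
  \sum_(k < j - i) germ phi x (pnt 0 r (i + k)) (pnt 0 r (i + k).+1).
Proof.
move=> pr ij jr; have r_lt := steps_lt (pnt_incr pr).
have ltE k l : (k <= size r)%N -> (l <= size r)%N ->
    (pnt 0 r k < pnt 0 r l) = (k < l)%N.
  move=> kr lr; case: (ltnP k l) => h; first by rewrite r_lt.
  rewrite ltNge (steps_le (fun i h => ltW (pnt_incr pr h))) //.
pose F k := germ phi x (pnt 0 r k) (pnt 0 r k.+1).
have cutoffS l : (l <= size r)%N ->
    path_sum (germ (cutoff phi (pnt 0 r l)) x) 0 r = \sum_(k < l) F k.
  move=> lr; rewrite /path_sum.
  rewrite -(big_mkord xpredT (fun k => germ (cutoff phi (pnt 0 r l)) x (pnt 0 r k) (pnt 0 r k.+1))).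
  rewrite (big_cat_nat (n := l)) //= -[RHS]addr0; congr (_ + _).
    rewrite big_nat -(big_mkord xpredT F) [RHS]big_nat.
    apply: eq_bigr => k /andP[_ kl]; have kr := ltnW (leq_trans kl lr).
    rewrite /F /germ cutoffE; last by have /andP[] := pnt_itv pr kr.
    by rewrite ltE // kl mul1r.
  rewrite big_nat big1 // => k /andP[lk kr].
  rewrite /germ cutoffE; last by have /andP[] := pnt_itv pr (ltnW kr).
  by rewrite ltE ?(ltnW kr) // ltnNge lk mul0r scale0r.
rewrite !cutoffS ?(leq_trans ij) //.
rewrite -(big_mkord xpredT F) (big_cat_nat (n := i)) //= big_mkord addrAC subrr add0r.
rewrite -{1}[i]add0n big_addn big_mkord; apply: eq_bigr => k _.
by rewrite /F addnC.
Qed.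

(** The path [x] has infinite [rho]-variation in norm in general, but its scalar
    projections [<x, v>] have finite [rho]-variation, and the scalar Young
    estimate applies to them; [C] does not depend on [v], [s] and [t]. *)
Lemma young_integral_dot_le phi x : bv T q phi ->
  grid_bv T rho (fun s t => dot (x s) (x t)) ->
  small_rectangles T (fun s t => dot (x s) (x t)) ->
  exists2 C, 0 <= C & forall v s t A, 0 <= s -> s < t -> t <= T -> 0 <= A ->
    path_var rho s t (fun u => dot (x u) v) A ->
    `|dot (young_integral phi x t - young_integral phi x s) v| <= C * A `^ rho^-1.
Proof.
move=> phibv Kbv Ksmall; have FF := mesh_to0_proper T_gt0.
have [B B0 phiB] := bv_bounded T_gt0 q_gt0 phibv.
have [M HM] := phibv.
pose W := M * M + T + 1; set c := sewing_constant q rho W.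
have c0 : 0 <= c.
  rewrite divr_ge0 ?sqrtr_ge0 // subr_ge0 ltW //.
  exact: (sewing_ratio_lt1 q_gt0 q_rho).
exists (c + B); first exact: addr_ge0.
move=> v s t A s0 st tT A0 xA.
have cv z : path_sum (germ (cutoff phi z) x) 0 @ mesh_to0 T --> young_integral phi x z.
  by apply: germ_cvg => //; apply: bv_cutoff.
have vcst : (fun _ : seq R => v) @ mesh_to0 T --> v by apply: cvg_cst.
apply: mesh_lim_le (dot_cvg ip (cvgB (cv t) (cv s)) vcst) _ => delta d0.
have [r0 pr0 mr0] := small_mesh_partition T_gt0 d0.
have [|r [pr sub1 sub2]] := @itv_partition_refine _ _ r0 [:: s; t] pr0 T_gt0.
  move=> y; rewrite !inE => /orP[/eqP ->|/eqP ->].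
    by rewrite s0 (le_trans (ltW st)).
  by rewrite tT (le_trans s0 (ltW st)).
exists r; split=> //; first exact: mesh_refine pr0 pr sub1 d0 mr0.
have [i ir si] : exists2 i, (i <= size r)%N & s = pnt 0 r i.
  by apply/mem_pnt/sub2; rewrite inE eqxx.
have [j jr tj] : exists2 i, (i <= size r)%N & t = pnt 0 r i.
  by apply/mem_pnt/sub2; rewrite !inE eqxx orbT.
have ij : (i <= j)%N.
  rewrite leqNgt; apply/negP => ji; move: st; rewrite si tj ltNge.
  by rewrite (steps_le (fun i h => ltW (pnt_incr pr h))) // ltnW.
rewrite /= [X in `|dot X _|](_ : _ =
   \sum_(k < j - i) germ phi x (pnt 0 r (i + k)) (pnt 0 r (i + k).+1)); last first.
  by rewrite {1}si {1}tj; apply: cutoff_path_sum.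
pose xi u := dot (x u) v.
pose p k := pnt 0 r (i + k).
have -> : dot (\sum_(k < j - i) germ phi x (pnt 0 r (i + k)) (pnt 0 r (i + k).+1)) v =
   \sum_(k < j - i) phi (p k) * (xi (p k.+1) - xi (p k)).
  rewrite (dot_suml ip); apply: eq_bigr => k _.
  by rewrite /germ (dotZl ip) (dotBl ip) /p addnS.
have phiM : path_var q s t phi M.
  by move=> n u /(chain_widen s0 tT) /HM.
have MW : M * M + (t - s) < W by rewrite /W; lra.
have := @scalar_young _ q rho q_gt0 rho_gt0 q_rho phi xi s t M A W st phiM xA A0 MW
  (j - i)%N p.
rewrite /p addn0 subnKC // => /(_ (esym si) (esym tj)) h.
have xst : `|xi t - xi s| <= A `^ rho^-1.
  have := xA 1%N _ (chain_pair (lexx s) (ltW st) (lexx t)); rewrite big_ord1 /= => hA.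
  rewrite -[leLHS](powRr1 (normr_ge0 _)) -(@mulfV _ rho) ?gt_eqF // powRrM.
  by apply: ge0_ler_powR; rewrite ?nnegrE ?powR_ge0 // invr_ge0 ltW.
rewrite mulrDl -[X in `|X|](subrK (phi s * (xi t - xi s))).
apply: le_trans (ler_normD _ _) _; apply: lerD.
  apply: h => k kj; rewrite addnS; apply: (pnt_incr pr).
  by apply: leq_trans jr; rewrite -ltn_subRL.
rewrite normrM; apply: ler_pM => //; apply: phiB.
by rewrite s0 (le_trans (ltW st)).
Qed.

End Integral.

(** * Grid variation of integrals *)
Section Duality.
Context {R : realType}.
Variable rho : R.
Hypothesis rho_ge1 : 1 <= rho.

Let rho_gt0 : 0 < rho. Proof. exact: lt_le_trans rho_ge1. Qed.

Lemma powRK (a r : R) : 0 <= a -> r != 0 -> (a `^ r) `^ r^-1 = a.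
Proof. by move=> a0 r0; rewrite -powRrM mulfV // powRr1. Qed.

Lemma powRVK (a r : R) : 0 <= a -> r != 0 -> (a `^ r^-1) `^ r = a.
Proof. by move=> a0 r0; rewrite -powRrM mulVf // powRr1. Qed.

Lemma powRM3 (a b c r : R) : 0 <= a -> 0 <= b -> 0 <= c ->
  (a * b * c) `^ r = a `^ r * b `^ r * c `^ r.
Proof. by move=> a0 b0 c0; rewrite !powRM // mulr_ge0. Qed.

(** Hoelder's inequality up to a factor 2, for the exponents that occur in
    the duality argument; the case [rho = 1] is included. *)
Lemma sum_holder (I : finType) (c X : I -> R) :
  (forall j, 0 <= c j) -> (forall j, 0 <= X j) -> 0 < \sum_j c j `^ rho ->
  \sum_j c j `^ (rho - 1) * X j <=
  2 * (\sum_j c j `^ rho) `^ ((rho - 1) / rho) * (\sum_j X j `^ rho) `^ rho^-1.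
Proof.
move=> c0 X0; set N := \sum_j c j `^ rho; set P := \sum_j X j `^ rho => N0.
have P0 : 0 <= P by apply: sumr_ge0 => *; apply: powR_ge0.
move: P0; rewrite le_eqVlt => /predU1P[P0|P0].
  have X_0 j : X j = 0.
    apply: (@powR_eq0_eq0 _ _ rho).
    have /eqP := esym P0; rewrite psumr_eq0; last by move=> *; apply: powR_ge0.
    by move=> /allP/(_ j (mem_index_enum _))/eqP.
  rewrite big1; first by rewrite !mulr_ge0 ?powR_ge0.
  by move=> j _; rewrite X_0 mulr0.
pose th := (rho - 1) / rho.
have th1 : 1 - th = rho^-1 by rewrite /th; field; rewrite gt_eqF.
have th01 : 0 <= th <= 1.
  rewrite divr_ge0 ?subr_ge0 ?(ltW rho_gt0) //= -subr_ge0 th1 invr_ge0.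
  exact: ltW.
have term j : c j `^ (rho - 1) * X j <=
    N `^ th * P `^ rho^-1 * (c j `^ rho / N + X j `^ rho / P).
  set A := c j `^ rho / N; set B := X j `^ rho / P.
  have A0 : 0 <= A by rewrite divr_ge0 ?powR_ge0 ?(ltW N0).
  have B0 : 0 <= B by rewrite divr_ge0 ?powR_ge0 ?(ltW P0).
  have -> : c j `^ (rho - 1) = N `^ th * A `^ th.
    rewrite -powRM ?(ltW N0) // /A mulrC divfK ?gt_eqF // -powRrM.
    by congr (_ `^ _); rewrite /th; field; rewrite gt_eqF.
  have -> : X j = P `^ rho^-1 * B `^ (1 - th).
    rewrite th1 -powRM ?(ltW P0) // /B mulrC divfK ?gt_eqF // -powRrM.
    by rewrite mulfV ?gt_eqF // powRr1.
  by rewrite mulrACA ler_wpM2l ?mulr_ge0 ?powR_ge0 // geometric_mean_le.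
apply: le_trans (ler_sum _ (fun j _ => term j)) _.
rewrite -mulr_sumr big_split /= -!mulr_suml divff ?gt_eqF // divff ?gt_eqF //.
move: (N `^ _) (P `^ _) => y z.
by rewrite (_ : y * z * (1 + 1) = 2 * y * z) //; ring.
Qed.

Variables (H : completeNormedModType R) (dot : H -> H -> R) (T q : R).
Hypotheses (ip : is_inner_product dot) (T_gt0 : 0 < T).
Hypotheses (q_gt0 : 0 < q) (q_rho : 1 < q^-1 + rho^-1).

(** A bound on [<y, v>] by the [rho]-variation of [<x, v>], for all [v], implies
    a bound on the vector of the [<y, h_j>] by the [rho]-variation of the
    path of vectors [(<x, h_j>)_j] in the [l^rho] norm. Estimating each [<y, h_j>]
    separately would require partitions depending on [j], which grid
    variation does not control. Instead test with [v = sum_j beta_j h_j], where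
    [beta] realises the duality of [l^rho] with its dual. *)
Lemma dual_variation (x : R -> H) (y : H) (C s t V : R) m (h : 'I_m -> H) :
  0 <= C ->
  (forall v A, 0 <= A -> path_var rho s t (fun u => dot (x u) v) A ->
     `|dot y v| <= C * A `^ rho^-1) ->
  (forall n u, chain s t n u -> \sum_(i < n)
     \sum_j `|dot (x (u i.+1) - x (u i)) (h j)| `^ rho <= V) -> 0 <= V ->
  \sum_j `|dot y (h j)| `^ rho <= (2 * C) `^ rho * V.
Proof.
move=> C0 Hy HV V0; set N := \sum_j _.
have : 0 <= N by apply: sumr_ge0 => *; apply: powR_ge0.
rewrite le_eqVlt => /predU1P[<-|N0]; first by rewrite mulr_ge0 ?powR_ge0.
pose c j := `|dot y (h j)|; pose th := (rho - 1) / rho.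
pose beta j := Num.sg (dot y (h j)) * c j `^ (rho - 1).
pose v := \sum_j beta j *: h j.
have yv : dot y v = N.
  rewrite /v (dot_sumr ip); apply: eq_bigr => j _.
  rewrite (dotZr ip) /beta mulrAC -normrEsg -/(c j) mulr_powRB1 //.
  exact: normr_ge0.
have beta_le j : `|beta j| <= c j `^ (rho - 1).
  rewrite normrM [X in _ * X]ger0_norm ?powR_ge0 // ler_piMl ?powR_ge0 //.
  by rewrite normr_sg; case: (_ != 0).
pose A := 2 `^ rho * N `^ (rho - 1) * V.
have A0 : 0 <= A by rewrite !mulr_ge0 ?powR_ge0.
have xA : path_var rho s t (fun u => dot (x u) v) A.
  move=> n u cu; apply: (@le_trans _ _ (\sum_(i < n) 2 `^ rho * N `^ (rho - 1) *
      \sum_j `|dot (x (u i.+1) - x (u i)) (h j)| `^ rho)); last first.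
    by rewrite -mulr_sumr ler_wpM2l ?mulr_ge0 ?powR_ge0 // HV.
  apply: ler_sum => i _; set P := \sum_j _.
  have P0 : 0 <= P by apply: sumr_ge0 => *; apply: powR_ge0.
  have hle : `|dot (x (u i.+1)) v - dot (x (u i)) v| <=
      2 * N `^ th * P `^ rho^-1.
    rewrite -(dotBl ip) /v (dot_sumr ip) (le_trans (ler_norm_sum _ _ _)) //.
    have cge0 j : 0 <= c j by apply: normr_ge0.
    pose X j := `|dot (x (u i.+1) - x (u i)) (h j)|.
    have Xge0 j : 0 <= X j by apply: normr_ge0.
    apply: le_trans (sum_holder cge0 Xge0 N0).
    apply: ler_sum => k _; rewrite (dotZr ip) normrM ler_wpM2r //.
  apply: le_trans (powR_norm_le rho_gt0 hle) _.
  have rr : rho != 0 by rewrite gt_eqF.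
  rewrite (powRM3 _ (ler0n _ 2) (powR_ge0 _ _) (powR_ge0 _ _)).
  rewrite [X in _ * _ * X](powRVK P0 rr) -powRrM.
  by rewrite /th divfK ?gt_eqF.
have := Hy v A A0 xA; rewrite yv ger0_norm ?(ltW N0) // => hN.
have N_th : 0 < N `^ th by rewrite powR_gt0.
have h1 : N `^ rho^-1 <= 2 * C * V `^ rho^-1.
  rewrite -(ler_pM2l N_th) -powRD; last by rewrite (gt_eqF N0) implybT.
  have -> : th + rho^-1 = 1 by rewrite /th; field; rewrite gt_eqF.
  rewrite powRr1 ?(ltW N0) //; apply: le_trans hN _.
  rewrite /A powRM3 ?powR_ge0 // (@powRK 2 rho) ?gt_eqF // -powRrM -/th.
  by move: (N `^ _) (V `^ _) => y1 y2; rewrite (_ : C * _ = y1 * (2 * C * y2)) //; ring.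
have C20 : 0 <= 2 * C by rewrite mulr_ge0.
rewrite -(@powRVK N rho) ?(ltW N0) ?gt_eqF // -(@powRVK V rho) ?gt_eqF //.
rewrite -powRM ?powR_ge0 //; apply: ge0_ler_powR => //; first exact: ltW.
  by rewrite nnegrE powR_ge0.
by rewrite nnegrE mulr_ge0 ?powR_ge0.
Qed.

(** The increments of [h] along the second partition are fixed; the first
    variable then sees a single path of vectors, with a superadditive control. *)
Lemma grid_bv_young_integral (phi : R -> R) (x h : R -> H) : bv T q phi ->
  grid_bv T rho (fun s t => dot (x s) (x t)) ->
  small_rectangles T (fun s t => dot (x s) (x t)) ->
  grid_bv T rho (fun s t => dot (x s) (h t)) ->
  grid_bv T rho (fun s t => dot (young_integral T phi x s) (h t)).
Proof.
move=> phibv Kbv Ksmall [M HM].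
have [C C0 HC] := young_integral_dot_le ip T_gt0 q_gt0 rho_gt0 q_rho phibv Kbv Ksmall.
exists ((2 * C) `^ rho * M) => n u m v cu cv; have [u1 u2] := cu.
pose hj (j : 'I_m) := h (v j.+1) - h (v j).
pose f a b := \sum_j `|dot (x b - x a) (hj j)| `^ rho.
have f0 a b : 0 <= f a b by apply: sumr_ge0 => *; apply: powR_ge0.
have fM k w : chain 0 T k w -> \sum_(i < k) f (w i) (w i.+1) <= M.
  move=> cw; have := HM _ _ _ _ cw cv; rewrite /grid_sum.
  by under eq_bigr do under eq_bigr do rewrite (rect_incr_dot ip).
apply: (@le_trans _ _ (\sum_(i < n) (2 * C) `^ rho * vsup f (u i) (u i.+1))).
  apply: ler_sum => i _; under eq_bigr do rewrite (rect_incr_dot ip).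
  have /andP[s0 _] := u2 i (ltnW (ltn_ord i)).
  have /andP[_ tT] := u2 i.+1 (ltn_ord i).
  have := u1 i (ltn_ord i); rewrite le_eqVlt => /predU1P[e|st].
    rewrite big1; last first.
      by move=> j _; rewrite e subrr (dot0l ip) normr0 powR0 ?gt_eqF.
    by rewrite mulr_ge0 ?powR_ge0 // (vsup_ge0 f0 fM) // e.
  apply: (dual_variation (x := x) (s := u i) (t := u i.+1)) => //.
  - by move=> w A A0 xA; apply: HC xA.
  - by move=> k w cw; apply: (vsup_ub fM s0 tT cw).
  - by rewrite (vsup_ge0 f0 fM) // ltW.
by rewrite -mulr_sumr ler_wpM2l ?powR_ge0 // (sum_vsup_le f0 fM).
Qed.

End Duality.

(** * Piecewise regular paths and continuous kernels *)
Section Piecewise.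
Context {R : realType}.
Variable p : R.
Hypothesis p_gt0 : 0 < p.
Implicit Types (f : R -> R) (D : set R).

Definition var_on f D : Prop := exists M, forall n (u : nat -> R),
  (forall i, (i < n)%N -> u i <= u i.+1) -> (forall i, (i <= n)%N -> D (u i)) ->
  \sum_(i < n) `|f (u i.+1) - f (u i)| `^ p <= M.

Lemma var_on1 f a : var_on f [set a].
Proof.
exists 0 => n u _ ua; rewrite big1 // => i _.
have := ua i (ltnW (ltn_ord i)); have := ua i.+1 (ltn_ord i) => /= -> ->.
by rewrite subrr normr0 powR0 ?gt_eqF.
Qed.

Lemma var_on_dist f D M x y :
  (forall n (u : nat -> R),
    (forall i, (i < n)%N -> u i <= u i.+1) -> (forall i, (i <= n)%N -> D (u i)) ->
    \sum_(i < n) `|f (u i.+1) - f (u i)| `^ p <= M) ->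
  D x -> D y -> `|f x - f y| `^ p <= M.
Proof.
move=> HM; wlog xy : x y / y <= x.
  by move=> H; case: (leP y x) => [/H //|/ltW/H h Dx Dy]; rewrite distrC h.
move=> Dx Dy; have := HM 1%N (fun i => if i is 0%N then y else x).
by rewrite big_ord1; apply=> [[]//|[|i]].
Qed.

Lemma chain_split D1 D2 n (u : nat -> R) :
  (forall x y, D1 x -> D2 y -> x < y) ->
  (forall i, (i < n)%N -> u i <= u i.+1) ->
  (forall i, (i <= n)%N -> (D1 `|` D2) (u i)) ->
  exists2 k, (k <= n.+1)%N & (forall i, (i < k)%N -> D1 (u i)) /\
     (forall i, (k <= i <= n)%N -> D2 (u i)).
Proof.
move=> D12; elim: n => [|n IH] u1 u2.
  have [h|h] := u2 0%N (leqnn _).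
    by exists 1%N => //; split; [case|case].
  by exists 0%N => //; split=> // i; rewrite leqn0 => /eqP ->.
have [|i ile|k kn [h1 h2]] := IH; [by move=> i /leqW; apply: u1 | exact/u2/leqW |].
have [h|h] := u2 n.+1 (leqnn _).
  have kE : k = n.+1.
    apply/eqP; rewrite eqn_leq kn leqNgt; apply/negP => kn'.
    have := D12 _ _ h (h2 n _); rewrite -ltnS kn' leqnn => /(_ isT).
    by rewrite ltNge u1.
  exists n.+2 => //; split=> i; first by rewrite ltnS leq_eqVlt => /predU1P[-> //|]; rewrite -kE => /h1.
  by move=> /andP[a b]; move: (leq_ltn_trans b a); rewrite ltnn.
exists k; first exact: leqW.
split=> // i /andP[ki]; rewrite leq_eqVlt => /predU1P[-> //|]; rewrite ltnS => i_n.
by apply: h2; rewrite ki.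
Qed.

(** A chain crosses from [D1] to [D2] at most once, and the crossing term is
    bounded because [f] is bounded on both sets. *)
Lemma var_onU f D1 D2 : (forall x y, D1 x -> D2 y -> x < y) ->
  var_on f D1 -> var_on f D2 -> var_on f (D1 `|` D2).
Proof.
move=> D12 [M1 HM1] [M2 HM2].
have M10 : (exists x, D1 x) -> 0 <= M1.
  by move=> [x Dx]; have := HM1 0%N (fun=> x); rewrite big_ord0; apply.
have M20 : (exists x, D2 x) -> 0 <= M2.
  by move=> [x Dx]; have := HM2 0%N (fun=> x); rewrite big_ord0; apply.
have [C C0 HC] : exists2 C, 0 <= C &
    forall x y, D1 x -> D2 y -> `|f y - f x| `^ p <= C.
  have [[x0 Dx0]|no] := pselect (exists x, D1 x); last first.
    by exists 0 => // x y Dx; case: no; exists x.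
  have [[y0 Dy0]|no] := pselect (exists y, D2 y); last first.
    by exists 0 => // x y _ Dy; case: no; exists y.
  exists (2 `^ p * (2 `^ p * (M2 + `|f y0 - f x0| `^ p) + M1)).
    rewrite mulr_ge0 ?powR_ge0 // addr_ge0 ?mulr_ge0 ?powR_ge0 //.
      by rewrite addr_ge0 ?powR_ge0 // M20 //; exists y0.
    by rewrite M10 //; exists x0.
  move=> x y Dx Dy; rewrite -[f y - f x](subrKA (f x0)).
  apply: le_trans (powR_normD _ _ p_gt0) _; rewrite ler_wpM2l ?powR_ge0 //.
  apply: lerD; last exact: var_on_dist HM1 Dx0 Dx.
  rewrite -[f y - f x0](subrKA (f y0)).
  apply: le_trans (powR_normD _ _ p_gt0) _; rewrite ler_wpM2l ?powR_ge0 //.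
  by rewrite lerD2r; apply: var_on_dist HM2 Dy Dy0.
exists (Num.max M1 0 + C + Num.max M2 0) => n u u1 u2.
have m1 : M1 <= Num.max M1 0 by rewrite le_max lexx.
have m2 : M2 <= Num.max M2 0 by rewrite le_max lexx.
have z1 : 0 <= Num.max M1 0 by rewrite le_max lexx orbT.
have z2 : 0 <= Num.max M2 0 by rewrite le_max lexx orbT.
have [k kn [h1 h2]] := chain_split D12 u1 u2.
case: k kn h1 h2 => [|k] kn h1 h2.
  have := HM2 n u u1 (fun i h => h2 i h); lra.
move: kn; rewrite ltnS leq_eqVlt => /predU1P[kE|kn].
  rewrite kE in h1; have := HM1 n u u1 h1; lra.
have [m nE] : exists m, n = (k.+1 + m)%N by exists (n - k.+1)%N; rewrite subnKC.
rewrite nE in u1 h2 *; rewrite big_split_ord /= big_ord_recr /=.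
apply: lerD; first apply: lerD.
- apply: le_trans m1; apply: HM1 => i ik; last exact: h1.
  by apply: u1; apply: leq_trans (leq_addr _ _); apply: ltnW.
- by apply: HC; [exact: h1 | apply: h2; rewrite leqnn leq_addr].
- apply: le_trans m2; have := HM2 m (fun i => u (k.+1 + i)%N).
  under [in X in _ -> X]eq_bigr do rewrite -addnS.
  apply=> i im; first by rewrite addnS; apply: u1; rewrite ltn_add2l.
  by apply: h2; rewrite leq_addr leq_add2l.
Qed.

Lemma finite_pvar_var_on (E : normedModType R) (g : R -> E) f D :
  (forall x y, `|f x - f y| <= `|g x - g y|) -> finite_pvar_on p g D ->
  var_on f D.
Proof.
move=> fg [M HM]; exists M => n u u1 u2.
have [s [ps _ sD sums]] := chain_path u1.
have -> := sums (fun x y => `|f y - f x| `^ p) _; last first.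
  by move=> x; rewrite subrr normr0 powR0 ?gt_eqF.
apply: le_trans (HM (u 0%N) s ps _); last first.
  move=> y; rewrite inE => /predU1P[->|/sD[i ile ->]]; exact: u2.
by apply: ler_sum => k _; apply: ge0_ler_powR; rewrite ?nnegrE ?(ltW p_gt0).
Qed.

(** [[0, T]] is the ordered union of finitely many open intervals and points;
    the values at the breakpoints are arbitrary. *)
Lemma Cpw_bv (E : normedModType R) (g : R -> E) f T :
  (forall x y, `|f x - f y| <= `|g x - g y|) -> Cpw_pvar p T g -> bv T p f.
Proof.
move=> fg [r pr Hr].
have H i : (i <= size r)%N -> var_on f [set x | 0 <= x <= pnt 0 r i].
  elim: i => [|i IH] ir.
    have -> : [set x : R | 0 <= x <= pnt 0 r 0] = [set 0].
      apply/seteqP; split=> x /=; last by move=> ->; rewrite lexx.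
      by rewrite -eq_le => /eqP.
    exact: var_on1.
  have -> : [set x : R | 0 <= x <= pnt 0 r i.+1] =
     ([set x | 0 <= x <= pnt 0 r i] `|` `]pnt 0 r i, pnt 0 r i.+1[) `|`
     [set pnt 0 r i.+1].
    have h := pnt_incr pr ir; have /andP[h0 _] := pnt_itv pr (ltnW ir).
    apply/seteqP; split=> x /=.
      move=> /andP[x0]; rewrite le_eqVlt => /predU1P[->|xi]; first by right.
      left; case: (leP x (pnt 0 r i)) => hx; first by left; rewrite x0.
      by right; rewrite in_itv /= hx.
    case=> [[/andP[-> hx]|]|->].
    - by rewrite (le_trans hx (ltW h)).
    - by rewrite in_itv /= => /andP[a /ltW ->]; rewrite (le_trans h0 (ltW a)).
    - by rewrite lexx (le_trans h0 (ltW h)).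
  apply: var_onU; last exact: var_on1.
    have h := pnt_incr pr ir.
    move=> x y /= [/andP[_ hx]|]; last by rewrite in_itv /= => /andP[_ hx] ->.
    by move=> ->; apply: le_lt_trans hx h.
  apply: var_onU; last by apply: finite_pvar_var_on fg _; have [] := Hr i ir.
    by move=> x y /= /andP[_ hx]; rewrite in_itv /= => /andP[hy _]; apply: le_lt_trans hx hy.
  exact/IH/ltnW.
have [M HM] := H (size r) (leqnn _); rewrite (pnt_top pr) in HM.
by exists M => n u [u1 u2]; apply: HM.
Qed.

End Piecewise.

Lemma mx_entry_norm_le (R : realType) m n (A : 'M[R]_(m, n)) i j :
  `|A i j| <= `|A|.
Proof.
rewrite -[leRHS]/(mx_norm A) mx_normrE.
exact: (le_bigmax 0 (fun k : 'I_m * 'I_n => `|A k.1 k.2|) (i, j)).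
Qed.

(** A rectangular increment is a difference of two increments of [K] in its
    first variable, and [K] is uniformly continuous on the compact square. *)
Lemma small_rectangles_continuous (R : realType) (T : R) (K : R -> R -> R) :
  {within `[0, T] `*` `[0, T], continuous (fun z : R * R => K z.1 z.2)} ->
  small_rectangles T K.
Proof.
move=> /subspace_continuousP Kc eps eps0.
pose Q : set (R * R) := `[0, T] `*` `[0, T].
have cQ : compact Q by apply: compact_setX; apply: segment_compact.
pose P (delta : R) (z : R * R) : Prop := forall z', Q z -> Q z' ->
  ball z delta z' -> `|K z.1 z.2 - K z'.1 z'.2| < eps / 2.
have HQ : \forall d \near (0 : R)^'+, Q `<=` P d.
  move/compact_near_coveringP: cQ; apply => z Qz.
  have /cvgrPdist_lt /(_ (eps / 4)) := Kc z Qz.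
  rewrite divr_gt0 // => /(_ isT); rewrite near_withinE => /nbhs_ballP[eta eta0 Heta].
  exists (ball z (eta / 2), [set d | d < eta / 2]) => /=.
    split; first by apply: nbhsx_ballx; rewrite divr_gt0.
    by apply: nbhs_right_lt; rewrite divr_gt0.
  move=> [z1 d] /= [zz1 d_lt] z' Qz1 Qz' z1z'.
  have h1 : `|K z.1 z.2 - K z1.1 z1.2| < eps / 4.
    apply: Heta Qz1; apply: le_ball zz1.
    by rewrite ler_pdivrMr // ler_peMr ?ler1n // ltW.
  have h2 : `|K z.1 z.2 - K z'.1 z'.2| < eps / 4.
    apply: Heta Qz'; rewrite [eta]splitr; apply: ball_triangle zz1 _.
    exact: le_ball (ltW d_lt) _ z1z'.
  rewrite -(subrKA (K z.1 z.2)); apply: le_lt_trans (ler_normD _ _) _.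
  by rewrite distrC; move: h1 h2; lra.
have [delta [delta0 HP]] := filter_ex (filterI (nbhs_right_gt (0 : R)) HQ).
have bound z1 z2 z1' : 0 <= z1 <= T -> 0 <= z2 <= T -> 0 <= z1' <= T ->
    `|z1 - z1'| < delta -> `|K z1 z2 - K z1' z2| < eps / 2.
  move=> z1T z2T z1'T dist.
  apply: (HP (z1, z2) _ (z1', z2)) => //; try by split; rewrite /= in_itv.
  by split=> /=; [rewrite -ball_normE | exact: ballxx].
exists delta => // u t u' t' u0 ut tT u'0 u't' t'T tu _.
have utd : `|u - t| < delta by rewrite distrC ger0_norm // subr_ge0.
have uT : 0 <= u <= T by rewrite u0 (le_trans ut).
have tT' : 0 <= t <= T by rewrite tT (le_trans u0).
have := bound u u' t uT _ tT' utd; rewrite u'0 (le_trans u't') // => /(_ isT) h1.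
have := bound u t' t uT _ tT' utd; rewrite t'T (le_trans u'0) // => /(_ isT) h2.
have -> : rect_incr K u t u' t' = (K u u' - K t u') - (K u t' - K t t').
  by rewrite /rect_incr; ring.
apply: le_trans (ler_normB _ _) _; move: h1 h2; lra.
Qed.

(** * The Volterra kernel in the tensor square *)
Section Assembly.
Context {R : realType}.

Lemma cvg_finite_sum (V : normedModType R) (I : Type) (s : seq I) (X : Type)
    (F : set_system X) {FF : Filter F} (f : I -> X -> V) (l : I -> V) :
  (forall i, f i @ F --> l i) ->
  (\sum_(i <- s) f i x) @[x --> F] --> \sum_(i <- s) l i.
Proof.
move=> fl; elim: s => [|i s IH].
  rewrite big_nil (_ : (fun _ => _) = cst 0); first exact: cvg_cst.
  by apply/funext => x; rewrite big_nil.
rewrite big_cons; under eq_fun do rewrite big_cons.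
exact: cvgD (fl i) IH.
Qed.

Variables (d : nat) (T : R) (K : R -> R -> R).
Variables (H1 H2 : completeNormedModType R).
Variables (dot1 : H1 -> H1 -> R) (dot2 : H2 -> H2 -> R).
Variables (ind : R -> 'I_d -> H1) (tens : H1 -> H1 -> H2).
Hypotheses (T_gt0 : 0 < T) (H1P : is_H1 T K dot1 ind).
Hypothesis H2P : is_hilbert_tensor dot1 dot2 tens.

Let ip1 : is_inner_product dot1. Proof. exact: H1_inner H1P. Qed.
Let ip2 : is_inner_product dot2. Proof. exact: tens_inner H2P. Qed.
Let FF : ProperFilter (mesh_to0 T) := mesh_to0_proper T_gt0.

Lemma dot_ind_itv a b c e (u v : 'I_d) : 0 <= a <= T -> 0 <= b <= T ->
  0 <= c <= T -> 0 <= e <= T ->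
  dot1 (ind_itv ind a b u) (ind_itv ind c e v) = (u == v)%:R * rect_incr K a b c e.
Proof.
move=> aT bT cT eT; rewrite /ind_itv !(dotBl ip1, dotBr ip1).
by rewrite !(H1_ind H1P) ?in_itv //= /rect_incr; ring.
Qed.

Lemma tensBl x y z : tens (x - y) z = tens x z - tens y z.
Proof.
have -> : x - y = (-1) *: y + x by rewrite scaleN1r addrC.
by rewrite (tens_linl H2P) scaleN1r addrC.
Qed.

Lemma tensNl x z : tens (- x) z = - tens x z.
Proof.
have tens0 : tens 0 z = 0 by rewrite -(subrr x) tensBl subrr.
by rewrite -sub0r tensBl tens0 sub0r.
Qed.

Lemma tensBr x y z : tens z (x - y) = tens z x - tens z y.
Proof.
have -> : x - y = (-1) *: y + x by rewrite scaleN1r addrC.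
by rewrite (tens_linr H2P) scaleN1r addrC.
Qed.

Lemma tens0r z : tens z 0 = 0.
Proof. by rewrite -(subrr 0) tensBr subrr. Qed.

Lemma step_approxE (f : R -> 'cV[R]_d) r :
  step_approx ind f r =
  \sum_(u < d) path_sum (germ (fun s => f s u 0) (ind^~ u)) 0 r.
Proof. by rewrite /step_approx exchange_big. Qed.

(** The Ito isometry for step functions. *)
Lemma dot_step_approx (f f' : R -> 'cV[R]_d) r r' :
  itv_partition 0 T r -> itv_partition 0 T r' ->
  dot1 (step_approx ind f r) (step_approx ind f' r') =
  young2_sum K (fun s t => \sum_(u < d) f s u 0 * f' t u 0) (r, r').
Proof.
move=> pr pr'; rewrite /step_approx (dot_suml ip1); apply: eq_bigr => i _ /=.
rewrite (dot_sumr ip1); apply: eq_bigr => j _.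
rewrite (dot_suml ip1) mulr_suml; apply: eq_bigr => u _.
rewrite (dot_sumr ip1) (bigD1 u) //= [X in _ + X]big1 => [|v vu].
  rewrite addr0 (dotZl ip1) (dotZr ip1) dot_ind_itv ?eqxx ?mul1r ?mulrA //;
  by apply: (pnt_itv (T := T)) => //; apply: ltnW.
rewrite (dotZl ip1) (dotZr ip1) dot_ind_itv; last 4 first.
- by apply: (pnt_itv pr); apply: ltnW.
- exact: (pnt_itv pr).
- by apply: (pnt_itv pr'); apply: ltnW.
- exact: (pnt_itv pr').
by rewrite eq_sym (negbTE vu) mul0r !mulr0.
Qed.

Variables (q rho : R) (g1 g2 : R -> 'M[R]_d).
Hypotheses (q_gt0 : 0 < q) (rho_ge1 : 1 <= rho) (rho_q : rho <= q).
Hypothesis (q_rho : 1 < q^-1 + rho^-1).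
Hypothesis (g1_bv : forall i j, bv T q (fun s => g1 s i j)).
Hypothesis (g2_bv : forall i j, bv T q (fun s => g2 s i j)).
Hypotheses (K_bv : grid_bv T rho K) (K_small : small_rectangles T K).

Let rho_gt0 : 0 < rho. Proof. exact: lt_le_trans rho_ge1. Qed.
Let g := volterra_g g1 g2.

Lemma rect_incr_ind_itv a b c e (u v : 'I_d) : 0 <= a <= T -> 0 <= b <= T ->
  0 <= c <= T -> 0 <= e <= T ->
  rect_incr (fun s t => dot1 (ind s u) (ind t v)) a b c e =
  (u == v)%:R * rect_incr K a b c e.
Proof.
by move=> aT bT cT eT; rewrite (rect_incr_dot ip1) -dot_ind_itv.
Qed.

Lemma ind_bv u v : grid_bv T rho (fun s t => dot1 (ind s u) (ind t v)).
Proof.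
have [M HM] := K_bv; exists M => n w m w' cw cw'.
have [_ w2] := cw; have [_ w2'] := cw'.
apply: le_trans (HM _ _ _ _ cw cw'); apply: ler_sum => i _; apply: ler_sum => j _.
rewrite rect_incr_ind_itv ?w2 ?w2' ?(ltnW (ltn_ord _)) //.
by apply: powR_norm_le => //; case: eqP; rewrite ?mul1r ?mul0r ?normr0.
Qed.

Lemma ind_small u : small_rectangles T (fun s t => dot1 (ind s u) (ind t u)).
Proof.
move=> eps /K_small[delta delta0 HK]; exists delta => //.
move=> a b c e a0 ab bT c0 ce eT ba ec.
rewrite rect_incr_ind_itv ?eqxx ?mul1r; last 4 first.
- by rewrite a0 (le_trans ab).
- by rewrite bT (le_trans a0).
- by rewrite c0 (le_trans ce).
- by rewrite eT (le_trans c0).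
exact: HK.
Qed.

(** The integral of the entry [(a, l)] of [g2] against the component [u] of the
    indicator path, where [k = (u, a)]. *)
Definition volterra_y (l : 'I_d) (k : 'I_d * 'I_d) : R -> H1 :=
  young_integral T (fun s => g2 s k.2 l) (ind^~ k.1).

(** The element of [H1] represented by [s |-> g(s, t) e_l]. *)
Definition volterra_col (l : 'I_d) (t : R) : H1 :=
  \sum_(k : 'I_d * 'I_d) g1 t k.1 k.2 *: volterra_y l k t.

Lemma step_approx_volterra_cvg l t :
  step_approx ind (fun s => col l (g s t)) @ mesh_to0 T --> volterra_col l t.
Proof.
rewrite (_ : step_approx _ _ = fun r => \sum_(k : 'I_d * 'I_d) g1 t k.1 k.2 *:
   path_sum (germ (cutoff (fun s => g2 s k.2 l) t) (ind^~ k.1)) 0 r); last first.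
  apply/funext => r; rewrite step_approxE.
  rewrite -(pair_bigA _ (fun u a => g1 t u a *:
   path_sum (germ (cutoff (fun s => g2 s a l) t) (ind^~ u)) 0 r)) /=.
  apply: eq_bigr => u _; under [RHS]eq_bigr do rewrite /path_sum scaler_sumr.
  rewrite [RHS]exchange_big /=; apply: eq_bigr => i _.
  rewrite /germ; under [RHS]eq_bigr do rewrite scalerA.
  rewrite -scaler_suml; congr (_ *: _); rewrite !mxE mulr_sumr.
  by apply: eq_bigr => a _; rewrite /cutoff mulrCA.
apply: cvg_finite_sum => k; apply: cvgZr; rewrite /volterra_y /young_integral.
apply: (germ_cvg ip1 T_gt0 q_gt0 rho_gt0 q_rho).
- exact: bv_cutoff.
- exact: ind_bv.
- exact: ind_small.
Qed.

Lemma path_elem_volterra l t :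
  path_elem T ind (fun s => col l (g s t)) = volterra_col l t.
Proof. exact: (cvg_lim (@norm_hausdorff _ _) (@step_approx_volterra_cvg l t)). Qed.

Lemma volterra_y0 l k : volterra_y l k 0 = 0.
Proof.
rewrite /volterra_y /young_integral.
rewrite (_ : path_sum _ _ = fun=> 0); first exact: (cvg_lim (@norm_hausdorff _ _) (cvg_cst _)).
apply/funext => r; rewrite /path_sum big1 // => i _.
rewrite /germ /cutoff indicE (_ : _ \in _ = false) ?mul0r ?scale0r //.
apply/negbTE; rewrite mem_setE in_itv /=; apply/negP => /andP[a b].
by move: (le_lt_trans a b); rewrite ltxx.
Qed.

(** Integrate in the first variable, exchange the variables by symmetry of the
    inner product, and integrate again. *)
Lemma volterra_y_bv l k l' k' :
  grid_bv T rho (fun s t => dot1 (volterra_y l k s) (volterra_y l' k' t)).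
Proof.
have step (a b : 'I_d * 'I_d) m (h : R -> H1) :
    grid_bv T rho (fun s t => dot1 (ind s a.1) (h t)) ->
    grid_bv T rho (fun s t => dot1 (volterra_y m a s) (h t)).
  move=> hb; apply: (grid_bv_young_integral rho_ge1 ip1 T_gt0 q_gt0 q_rho) => //.
    exact: ind_bv.
  exact: ind_small.
apply: (step) => //.
have -> : (fun s t => dot1 (ind s k.1) (volterra_y l' k' t)) =
    (fun s t => dot1 (volterra_y l' k' t) (ind s k.1)).
  by apply/funext => s; apply/funext => t; rewrite (dotC ip1).
apply: (@grid_bv_flip _ _ _ (fun s t => dot1 (volterra_y l' k' s) (ind t k.1))).
by apply: (step) => //; apply: ind_bv.
Qed.

(** The integrals vanish at time 0, as required for multiplication by the
    entries of [g1]; the exponent is raised from [rho] to [q] to accommodate them. *)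
Lemma volterra_col_bv l :
  grid_bv T q (fun s t => dot1 (volterra_col l s) (volterra_col l t)).
Proof.
rewrite (_ : (fun _ _ => _) = fun s t => \sum_(k : 'I_d * 'I_d)
  \sum_(k' : 'I_d * 'I_d) g1 s k.1 k.2 * (g1 t k'.1 k'.2 *
     dot1 (volterra_y l k s) (volterra_y l k' t))); last first.
  apply/funext => s; apply/funext => t; rewrite /volterra_col (dot_suml ip1).
  apply: eq_bigr => k _; rewrite (dot_sumr ip1); apply: eq_bigr => k' _.
  by rewrite (dotZl ip1) (dotZr ip1).
apply: grid_bv_sum => // k; apply: grid_bv_sum => // k'.
apply: (@grid_bvMl _ _ T_gt0 q (fun s => g1 s k.1 k.2) (fun s t => g1 t k'.1 k'.2 *
     dot1 (volterra_y l k s) (volterra_y l k' t))) => //.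
  apply: (@grid_bvMr _ _ T_gt0 q (fun t => g1 t k'.1 k'.2)) => //.
    exact: (grid_bv_exponent rho_gt0 rho_q (@volterra_y_bv l k l k')).
  by move=> s; rewrite volterra_y0 (dot0r ip1).
by move=> t; rewrite volterra_y0 (dot0l ip1) mulr0.
Qed.

Definition tensor_germ (l : 'I_d) (s t : R) : H2 :=
  tens (volterra_col l s) (ind_itv ind s t l).

Lemma gpi_elemE r :
  gpi_elem T ind tens g r = \sum_(l < d) path_sum (tensor_germ l) 0 r.
Proof.
rewrite /gpi_elem exchange_big /=; apply: eq_bigr => i _.
by apply: eq_bigr => l _; rewrite path_elem_volterra.
Qed.

Lemma defect_tensor_germ l s u t : defect (tensor_germ l) s u t =
  - tens (volterra_col l u - volterra_col l s) (ind_itv ind u t l).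
Proof.
rewrite /defect /tensor_germ -tensBr.
have -> : ind_itv ind s t l - ind_itv ind s u l = ind_itv ind u t l.
  by rewrite /ind_itv opprB addrA subrK.
by rewrite -tensBl -opprB tensNl.
Qed.

Lemma tensor_germ_cvg l : cvg (path_sum (tensor_germ l) 0 @ mesh_to0 T).
Proof.
have [M HM] := volterra_col_bv l; have [N HN] := ind_bv l l.
apply: (hilbert_path_sum_cvg q_gt0 rho_gt0 q_rho T_gt0 _ _ HM HN).
- by move=> s; rewrite /tensor_germ /ind_itv subrr tens0r.
- exact: cauchy_schwarz_dot.
- exact: ind_small.
move=> n tau _.
pose F c := - tens (volterra_col l (tau c.*2.+1) - volterra_col l (tau c.*2))
  (ind_itv ind (tau c.*2.+1) (tau c.*2.+2) l).
under eq_bigr do rewrite defect_tensor_germ -/(F _).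
rewrite (sqr_norm_sum ip2); apply: ler_sum => c _; apply: ler_sum => c' _.
rewrite /F (dotNl ip2) (dotNr ip2) opprK (tens_dot H2P).
by rewrite !(rect_incr_dot ip1) -normrM ler_norm.
Qed.

Lemma gpi_elem_cvg : cvg (gpi_elem T ind tens g @ mesh_to0 T).
Proof.
rewrite (_ : gpi_elem _ _ _ _ = fun r => \sum_(l < d) path_sum (tensor_germ l) 0 r).
  apply: cvgP; apply: cvg_finite_sum => l; exact: tensor_germ_cvg.
by apply/funext => r; rewrite gpi_elemE.
Qed.

Definition volterra_inner (s t : R) : R :=
  young2_int T K (fun u v => hs_inner (g u s) (g v t)).

Lemma dot_cvg_prod (V : normedModType R) (dot : V -> V -> R) (f f' : seq R -> V) x y :
  is_inner_product dot -> f @ mesh_to0 T --> x -> f' @ mesh_to0 T --> y ->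
  dot (f rr.1) (f' rr.2) @[rr --> filter_prod (mesh_to0 T) (mesh_to0 T)]
    --> dot x y.
Proof.
move=> ip fx fy; apply: (dot_cvg ip).
- exact: (cvg_comp _ _ cvg_fst fx).
- exact: (cvg_comp _ _ cvg_snd fy).
Qed.

Lemma near_prod_partition :
  \forall rr \near filter_prod (mesh_to0 T) (mesh_to0 T),
    itv_partition 0 T rr.1 /\ itv_partition 0 T rr.2.
Proof.
have h : \forall r \near mesh_to0 T, itv_partition 0 T r.
  by exists 1 => [|r []//]; rewrite /= ltr01.
by exists ([set r | itv_partition 0 T r], [set r | itv_partition 0 T r]).
Qed.

(** The Young sum is an inner product of Riemann sums, one for each partition,
    so that it converges as the two meshes tend to 0 independently. *)
Lemma volterra_inner_cvg s t :
  young2_sum K (fun u v => hs_inner (g u s) (g v t)) @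
    filter_prod (mesh_to0 T) (mesh_to0 T) -->
  \sum_(l < d) dot1 (volterra_col l s) (volterra_col l t).
Proof.
apply: (@cvg_trans _ (\sum_(l < d) dot1 (step_approx ind (fun u => col l (g u s)) rr.1)
   (step_approx ind (fun u => col l (g u t)) rr.2)
   @[rr --> filter_prod (mesh_to0 T) (mesh_to0 T)])); last first.
  apply: cvg_finite_sum => l; apply: dot_cvg_prod => //; exact: step_approx_volterra_cvg.
apply: near_eq_cvg; apply: filterS near_prod_partition => -[r r'] /= [pr pr'].
under eq_bigr do rewrite dot_step_approx //.
rewrite /young2_sum exchange_big; apply: eq_bigr => i _ /=.
rewrite exchange_big; apply: eq_bigr => j _ /=.
rewrite -mulr_suml; congr (_ * _).
rewrite /hs_inner exchange_big; apply: eq_bigr => u _; apply: eq_bigr => v _.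
by rewrite !mxE.
Qed.

Lemma volterra_innerE s t :
  volterra_inner s t = \sum_(l < d) dot1 (volterra_col l s) (volterra_col l t).
Proof.
have prodF := @filter_prod_proper _ _ _ _ FF FF.
exact: (cvg_lim (@Rhausdorff R) (@volterra_inner_cvg s t)).
Qed.

(** The inner Young integral is already evaluated as a sum of inner products of
    columns, so the outer sum is exactly an inner product in the tensor square. *)
Lemma dot_gpi_elem r r' : itv_partition 0 T r -> itv_partition 0 T r' ->
  dot2 (gpi_elem T ind tens g r) (gpi_elem T ind tens g r') =
  young2_sum K volterra_inner (r, r').
Proof.
move=> pr pr'; rewrite /gpi_elem (dot_suml ip2); apply: eq_bigr => i _ /=.
rewrite (dot_sumr ip2); apply: eq_bigr => j _.
rewrite (dot_suml ip2) volterra_innerE mulr_suml; apply: eq_bigr => u _.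
rewrite (dot_sumr ip2) (bigD1 u) //= [X in _ + X]big1 => [|v vu].
  rewrite addr0 (tens_dot H2P) !path_elem_volterra dot_ind_itv ?eqxx ?mul1r //;
  by apply: (pnt_itv (T := T)) => //; apply: ltnW.
rewrite (tens_dot H2P) dot_ind_itv; last 4 first.
- by apply: (pnt_itv pr); apply: ltnW.
- exact: (pnt_itv pr).
- by apply: (pnt_itv pr'); apply: ltnW.
- exact: (pnt_itv pr').
by rewrite eq_sym (negbTE vu) mul0r !mulr0.
Qed.

Lemma outer_cvg :
  young2_sum K volterra_inner @ filter_prod (mesh_to0 T) (mesh_to0 T) -->
  `|g_elem T ind tens g| ^+ 2.
Proof.
rewrite -(dot_norm ip2).
apply: (@cvg_trans _ (dot2 (gpi_elem T ind tens g rr.1) (gpi_elem T ind tens g rr.2)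
   @[rr --> filter_prod (mesh_to0 T) (mesh_to0 T)])); last first.
  have gc : gpi_elem T ind tens g @ mesh_to0 T --> g_elem T ind tens g.
    exact: gpi_elem_cvg.
  exact: (dot_cvg_prod ip2 gc gc).
apply: near_eq_cvg; apply: filterS near_prod_partition => -[r r'] /= [pr pr'].
by rewrite dot_gpi_elem.
Qed.

End Assembly.

Theorem proposition4p7 (R : realType)
    (dO : measure_display) (Omega : measurableType dO)
    (P : probability Omega R) (d : nat) (T : R)
    (X : R -> 'I_d -> {RV P >-> R}) (K : R -> R -> R)
    (H1 H2 : completeNormedModType R)
    (dot1 : H1 -> H1 -> R) (dot2 : H2 -> H2 -> R)
    (ind : R -> 'I_d -> H1) (tens : H1 -> H1 -> H2)
    (p rho : R) (g1 g2 : R -> 'M[R]_d)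
    (d_gt0 : (0 < d)%N) (T_gt0 : 0 < T)
    (X_gaussian : centered_gaussian_process T X)
    (X_continuous : continuous_from_origin T X)
    (X_independent : independent_components T X)
    (X_identical : identically_distributed_components T X)
    (K_covariance : component_covariance T X K)
    (K_continuous :
       {within `[0, T] `*` `[0, T], continuous (fun z : R * R => K z.1 z.2)})
    (H1_completion : is_H1 T K dot1 ind)
    (H2_tensor : is_hilbert_tensor dot1 dot2 tens)
    (g1_pvar : Cpw_pvar p T g1) (g2_pvar : Cpw_pvar p T g2)
    (rho_ge1 : 1 <= rho) (rho_lt : rho < 3 / 2)
    (K_var : finite_2D_var rho T K)
    (p_rho : 1 / p + 1 / rho > 1) :
  let g := volterra_g g1 g2 in
  let inner s t := young2_int T K (fun u v => hs_inner (g u s) (g v t)) in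
  [/\ in_H1H1 T ind tens g,
      (forall s t, s \in `[0, T] -> t \in `[0, T] ->
         young2_integrable T K (fun u v => hs_inner (g u s) (g v t))) /\
      young2_integrable T K inner,
      `|g_elem T ind tens g| = Num.sqrt (young2_int T K inner) &
      `|gpi_elem T ind tens g r - g_elem T ind tens g| @[r --> mesh_to0 T]
         --> (0 : R)].
Proof.
have rho_gt0 : 0 < rho by apply: lt_le_trans rho_ge1.
have rhoV : rho^-1 <= 1 by rewrite invf_le1.
have p_gt0 : 0 < p.
  by rewrite -invr_gt0; move: p_rho; rewrite !div1r; lra.
pose q := Num.max p rho.
have p_q : p <= q by rewrite le_max lexx.
have rho_q : rho <= q by rewrite le_max lexx orbT.
have q_gt0 : 0 < q by apply: lt_le_trans p_q.
have q_rho : 1 < q^-1 + rho^-1.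
  rewrite /q; case: (leP p rho) => _; last by move: p_rho; rewrite !div1r.
  have : 2 / 3 < rho^-1 by rewrite -[2 / 3]invrK ltf_pV2 ?posrE // invf_div.
  lra.
have mx_bv (h : R -> 'M[R]_d) : Cpw_pvar p T h ->
    forall i j, bv T q (fun s => h s i j).
  move=> h_pvar i j.
  have [|M HM] := @Cpw_bv _ p p_gt0 _ h (fun s => h s i j) T _ h_pvar.
    by move=> x y; have := mx_entry_norm_le (h x - h y) i j; rewrite !mxE.
  by exists (M * M `^ ((q - p) / p)); apply: path_var_exponent.
have g1_bv := mx_bv _ g1_pvar; have g2_bv := mx_bv _ g2_pvar.
have K_bv : grid_bv T rho K by apply: grid_var_finite_2D.
have K_small := small_rectangles_continuous K_continuous.
have FF := mesh_to0_proper T_gt0.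
move=> g inner.
have g_cvg : gpi_elem T ind tens g @ mesh_to0 T --> g_elem T ind tens g.
  exact: (gpi_elem_cvg T_gt0 H1_completion H2_tensor q_gt0 rho_ge1 rho_q q_rho
    g1_bv g2_bv K_bv K_small).
have inner_cvg := outer_cvg T_gt0 H1_completion H2_tensor q_gt0 rho_ge1 rho_q q_rho
    g1_bv g2_bv K_bv K_small.
split.
- split=> [t j _|]; last by apply: cvgP g_cvg.
  apply: cvgP; exact: (step_approx_volterra_cvg T_gt0 H1_completion q_gt0 rho_ge1
    q_rho g2_bv K_bv K_small).
- split=> [s t _ _|]; last exact: cvgP inner_cvg.
  apply: cvgP; exact: (volterra_inner_cvg T_gt0 H1_completion q_gt0 rho_ge1
    q_rho g2_bv K_bv K_small).
- rewrite /young2_int (cvg_lim (@Rhausdorff R) inner_cvg).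
  by rewrite sqrtr_sqr normr_id.
- rewrite -(normr0 H2) -(subrr (g_elem T ind tens g)).
  by apply: cvg_norm; apply: cvgB => //; apply: cvg_cst.
Qed.
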